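(* Assume $c=1$, i.e. $a^{ij}b_ib_j=-1$, and $N\ge3$. Fix $x\in M$. In the time-like sector ($\epsilon=1$) and in the space-like sector ($\epsilon=-1$), the pseudo-Finsleroid indicatrix $\{y: F^2(x,y)=\epsilon\}$ is a space of constant curvature: if $m^a$ ($a=1,\dots,N-1$) are local coordinates on the indicatrix, $L^i=L^i(m)$ is the corresponding parametrization, and $i_{ab}=g_{ij}(x,L)\frac{\partial L^i}{\partial m^a}\frac{\partial L^j}{\partial m^b}$ is the induced metric, then the curvature tensor $I_{acbd}$ of $i_{ab}$ satisfies $$I_{acbd}=-\epsilon h^2\,(i_{cb}i_{ad}-i_{cd}i_{ab}).$$ Hence the indicatrix has the constant curvature value $$\mathcal R=-\epsilon h^2,$$ i.e. $\mathcal R=-\bigl(1+\tfrac14g^2\bigr)\le-1$ for $\epsilon=1$ and $\mathcal R=1-\tfrac14g^2\le1$ for $\epsilon=-1$.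
   Context: Let $M$ be an $N$-dimensional smooth manifold with a pseudo-Riemannian metric tensor $a_{ij}(x)$ of signature $(+,-,\dots,-)$ and inverse $a^{ij}$, a 1-form $b_i(x)$ with $a^{ij}b_ib_j=-1$, and a scalar field $g(x)$. For $y\in T_xM$ put $$b=b_i(x)y^i,\quad r_{ij}=a_{ij}+b_ib_j,\quad \gamma=r_{ij}y^iy^j,\quad q=\sqrt{|\gamma|},\quad B=\gamma-g\,b\,q-b^2 .$$ Time-like sector ($\epsilon=1$, any real $g$): the $y$ with $\gamma>0$ and $B>0$. There $h=\sqrt{1+g^2/4}$, $G=g/h$, $g_\pm=-\frac12g\pm h$, $B=(b-g_-q)(g_+q-b)$ and $J=\left(\frac{b-g_-q}{g_+q-b}\right)^{-G/4}$. Space-like sector ($\epsilon=-1$, $-2<g<2$): the $y$ with $\gamma<0$ (so $B=-(q^2+gbq+b^2)<0$). There $h=\sqrt{1-g^2/4}$, $G=g/h$, $L=q+\frac g2 b$, $J=e^{-\frac12 G f}$ with $f=-\arctan\frac G2+\arctan\frac{L}{hb}$ if $b<0$, $f=-\pi-\arctan\frac G2+\arctan\frac{L}{hb}$ if $b>0$ and, by continuity, $f=-\frac\pi2-\arctan\frac G2$ if $b=0$. (This scalar $L$ is unrelated to the vectors $L^i$ of the claim.) In both sectors $F^2=BJ^2$ and $g_{ij}=\frac12\frac{\partial^2F^2}{\partial y^i\partial y^j}$. Curvature convention: with $i_a{}^c{}_b$ the Christoffel symbols of $i_{ab}$, $$I_a{}^c{}_{bd}=\frac{\partial i_a{}^c{}_b}{\partial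 m^d}-\frac{\partial i_a{}^c{}_d}{\partial m^b}+i_a{}^e{}_b\,i_e{}^c{}_d-i_a{}^e{}_d\,i_e{}^c{}_b,\qquad I_{acbd}=i_{ce}I_a{}^e{}_{bd}.$$ The curvature value $\mathcal R$ is by convention the constant in $I_{acbd}=\mathcal R\,(i_{cb}i_{ad}-i_{cd}i_{ab})$ (equivalently the constant sectional curvature of the metric $-i_{ab}$, which is positive definite when $\epsilon=1$). *)

(* Defs.v *)
From HB Require Import structures.
From mathcomp Require Import all_boot all_order all_algebra.
From mathcomp Require Import all_classical all_reals all_analysis.

Set Implicit Arguments.
Unset Strict Implicit.
Unset Printing Implicit Defensive.

Import Order.TTheory GRing.Theory Num.Theory.
Import numFieldNormedType.Exports.

Local Open Scope classical_set_scope.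
Local Open Scope ring_scope.

(* Partial derivative along the i-th coordinate of R^n. *)
Definition pder (R : realType) (n : nat) (i : 'I_n) (f : 'rV[R]_n -> R)
    (p : 'rV[R]_n) : R :=
  'D_(delta_mx 0 i) f p.

(* C^oo on V: every iterated partial derivative is differentiable on V. *)
Definition smooth_on (R : realType) (n : nat) (V : set 'rV[R]_n)
    (f : 'rV[R]_n -> R) : Prop :=
  forall (s : seq 'I_n) (p : 'rV[R]_n), V p ->
    differentiable (foldr (@pder R n) f s) p.

Section Curvature.
Variables (R : realType) (n : nat).
(* The components of a metric, in the coordinates m^a of an open set of R^n. *)
Variable i_ : 'rV[R]_n -> 'M[R]_n.

(* christoffel a c b is the symbol i_a^c_b. *)
Definition christoffel (a c b : 'I_n) (m : 'rV[R]_n) : R :=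
  2^-1 * \sum_e invmx (i_ m) c e *
    (pder a (fun p => i_ p e b) m + pder b (fun p => i_ p e a) m
     - pder e (fun p => i_ p a b) m).

(* riemann_up a c b d is I_a^c_{bd}; the order of its indices differs from the
   usual R^c_{abd}, and I_a^c_{bd} = R^c_{adb} in the convention
   R^c_{abd} = d_b Gamma^c_{da} - ... *)
Definition riemann_up (a c b d : 'I_n) (m : 'rV[R]_n) : R :=
  pder d (christoffel a c b) m - pder b (christoffel a c d) m
  + \sum_e christoffel a e b m * christoffel e c d m
  - \sum_e christoffel a e d m * christoffel e c b m.

(* riemann a c b d is I_{acbd} = i_{ce} I_a^e_{bd}. *)
Definition riemann (a c b d : 'I_n) (m : 'rV[R]_n) : R :=
  \sum_e i_ m c e * riemann_up a e b d m.

(* The constant curvature value; with the above conventions this is minus the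
   sectional curvature of i_, i.e. the sectional curvature of - i_. *)
Definition curvature_value (V : set 'rV[R]_n) (K : R) : Prop :=
  forall m, V m -> forall a c b d : 'I_n,
    riemann a c b d m = K * (i_ m c b * i_ m a d - i_ m c d * i_ m a b).

End Curvature.

(* Signature (+,-,...,-): in a suitable basis (the rows of P) the symmetric
   form a is diag(1,-1,...,-1). *)
Definition has_signature_1_minus (R : realType) (N : nat) (a : 'M[R]_N) : Prop :=
  a^T = a /\
  exists2 P : 'M[R]_N, P \in unitmx &
    P *m a *m P^T = diag_mx (\row_j (if (j : nat) == 0%N then 1 else -1)).

Inductive sector := timelike | spacelike.

Section Finsleroid.
Variables (R : realType) (s : sector).

(* The sign epsilon. *)
Definition eps : R := if s is timelike then 1 else -1.

Definition hval (g : R) : R := Num.sqrt (1 + eps * (g ^+ 2 / 4)).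
Definition Gval (g : R) : R := g / hval g.

Definition admissible_g (g : R) : Prop :=
  if s is timelike then True else -2 < g /\ g < 2.

Definition g_plus (g : R) : R := - (2^-1 * g) + hval g.
Definition g_minus (g : R) : R := - (2^-1 * g) - hval g.

(* In the definitions with arguments g, b, q, the real number b stands for the
   value b_i y^i and q for sqrt |gamma|. *)

Definition fval (g b q : R) : R :=
  let h := hval g in
  let G := Gval g in
  let L := q + g / 2 * b in
  if b < 0 then - atan (G / 2) + atan (L / (h * b))
  else if 0 < b then - pi - atan (G / 2) + atan (L / (h * b))
  else - (pi / 2) - atan (G / 2).

Definition Jval (g b q : R) : R :=
  if s is timelike
  then ((b - g_minus g * q) / (g_plus g * q - b)) `^ (- (Gval g / 4))
  else expR (- (2^-1 * Gval g * fval g b q)).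

Variables (N : nat) (a : 'M[R]_N) (bform : 'rV[R]_N) (g : R).

Definition bval (y : 'rV[R]_N) : R := \sum_i bform 0 i * y 0 i.

Definition rform (i j : 'I_N) : R := a i j + bform 0 i * bform 0 j.

Definition gamma (y : 'rV[R]_N) : R :=
  \sum_i \sum_j rform i j * y 0 i * y 0 j.

Definition qval (y : 'rV[R]_N) : R := Num.sqrt `|gamma y|.

Definition Bval (y : 'rV[R]_N) : R :=
  gamma y - g * bval y * qval y - bval y ^+ 2.

Definition in_sector (y : 'rV[R]_N) : Prop :=
  if s is timelike then 0 < gamma y /\ 0 < Bval y else gamma y < 0.

(* F^2, of which only the restriction to the sector is meaningful. *)
Definition F2 (y : 'rV[R]_N) : R :=
  Bval y * Jval g (bval y) (qval y) ^+ 2.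

Definition indicatrix : set 'rV[R]_N :=
  [set y | in_sector y /\ F2 y = eps].

Definition finsler_metric (y : 'rV[R]_N) : 'M[R]_N :=
  \matrix_(i, j) (2^-1 * pder i (pder j F2) y).

(* Row a of the Jacobian consists of the d L^i / d m^a. *)
Definition param_jacobian (n : nat) (L : 'rV[R]_n -> 'rV[R]_N) (m : 'rV[R]_n) :
    'M[R]_(n, N) :=
  \matrix_(a, i) pder a (fun p => L p 0 i) m.

(* Since the dimension of the parameter space equals that of the hypersurface,
   an injective immersion L on V is automatically a diffeomorphism onto an open
   part of the indicatrix, so its inverse is a chart with coordinates m^a. *)
Definition local_parametrization (V : set 'rV[R]_N.-1)
    (L : 'rV[R]_N.-1 -> 'rV[R]_N) : Prop :=
  [/\ open V /\ V !=set0,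
      forall i, smooth_on V (fun m => L m 0 i),
      forall m, V m -> row_free (param_jacobian L m),
      set_inj V L
    & forall m, V m -> indicatrix (L m)].

Definition induced_metric (L : 'rV[R]_N.-1 -> 'rV[R]_N) (m : 'rV[R]_N.-1) :
    'M[R]_N.-1 :=
  \matrix_(c, d) \sum_i \sum_j finsler_metric (L m) i j
    * param_jacobian L m c i * param_jacobian L m d j.

End Finsleroid.

(* Main.v *)
Require Import Defs.
From HB Require Import structures.
From mathcomp Require Import all_boot all_order all_algebra.
From mathcomp Require Import all_classical all_reals all_analysis.
From mathcomp Require Import ring lra.

Set Implicit Arguments.
Unset Strict Implicit.
Unset Printing Implicit Defensive.

Import Order.TTheory GRing.Theory Num.Theory.
Import numFieldNormedType.Exports.

Local Open Scope classical_set_scope.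
Local Open Scope ring_scope.

(** Put [w = b + g q / 2], let [b#] be the vector [a]-dual to the
    1-form [b], [P = y + b(y) b#] the part of [y] annihilated by [b], and
      [Z(y) = (h P - w b#) / sqrt |B|].
    Since [h^2 gamma - w^2 = B], the map [Z] takes its values in the hyperquadric
    [a(Z, Z) = eps].  In both sectors the logarithmic derivative of [J^2] is
    [g (b dq - q db) / B]; this gives the Hessian of [F^2] in closed form, and on
    vectors tangent to the indicatrix it equals [h^-2 a(dZ, dZ)].  So the
    indicatrix is locally, up to the factor [h^-2], a hyperquadric of a
    pseudo-Euclidean space, and the Gauss equation gives the curvature. *)

(** * Smooth functions *)

(** Since [a(b#, b#) = -1], [a(P, b#) = 0] and [a(P, P) = gamma], the vector [h P - w b#] has square
    [h^2 gamma - w^2]: the scaling by [h] is what completes the square in [B]. On the indicatrix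
    [F^2 = B J^2 = eps] forces [J^2 = 1/|B|], so dividing by [sqrt |B|] reproduces exactly the
    factor [J^2] of the Hessian. The transcendental function [J] therefore enters only through its
    logarithmic derivative and is absent from [Z]. The two sectors then differ only by the sign
    [eps], and the computations rest on [h^2 = 1 + eps g^2/4] and [eps^2 = 1]. The obstacle on the
    analytic side is that [q] contains an absolute value and [f] is given by branches; their closed
    forms hold only where the sector conditions do, so derivatives are taken along lines, on which
    these conditions persist for small parameters. For the geometry, the position vector of a
    hyperquadric is its own normal. With metric [k a(dZ, dZ)] on [a(Z, Z) = c0] the curvature value
    is [-1/(k c0)]; here [k = h^-2] and [c0 = eps]. *)

Lemma is_derive_lineP (R : realType) (W : normedModType R) (f : W -> R)
    (x v : W) (df : R) :
  is_derive x v f df <-> is_derive (0 : R) 1 (fun h => f (h *: v + x)) df.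
Proof.
have eqD : 'D_v f x = 'D_1 (fun h : R => f (h *: v + x)) 0.
  rewrite /derive; set g1 := fun h => h^-1 *: _; set g2 := fun h => h^-1 *: _.
  suff -> : g1 = g2 by [].
  by rewrite funeqE /g1 /g2 => h /=; rewrite addr0 scale0r add0r [_%:A]mulr1.
have [D1 D2] := derivable1P f x v.
by split=> -[fx <-]; apply: DeriveDef; [exact: D1|rewrite eqD|exact: D2|rewrite eqD].
Qed.

(** Restriction to the line through [x] along [v] reduces this to the chain rule of one real
    variable, so a single directional derivative of [f] suffices. *)
Lemma is_derive_chain (R : realType) (W : normedModType R) (f : W -> R)
    (phi : R -> R) (x v : W) (df dphi : R) :
  is_derive x v f df -> is_derive (f x) 1 phi dphi ->
  is_derive x v (fun y => phi (f y)) (dphi * df).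
Proof.
move=> /is_derive_lineP fx phix; apply/is_derive_lineP.
by apply: (@is_derive1_comp _ phi (fun h => f (h *: v + x)));
  rewrite ?scale0r ?add0r.
Qed.

Section DeriveRules.
Variables (R : realType) (W : normedModType R) (x v : W).
Implicit Types (f g : W -> R) (df dg c : R).

Lemma deriv_add f g df dg : is_derive x v f df -> is_derive x v g dg ->
  is_derive x v (fun y => f y + g y) (df + dg).
Proof. exact: is_deriveD. Qed.

Lemma deriv_sub f g df dg : is_derive x v f df -> is_derive x v g dg ->
  is_derive x v (fun y => f y - g y) (df - dg).
Proof. exact: is_deriveB. Qed.

Lemma deriv_mul f g df dg : is_derive x v f df -> is_derive x v g dg ->
  is_derive x v (fun y => f y * g y) (df * g x + f x * dg).
Proof.
move=> fx gx; apply: is_derive_eq (is_deriveM fx gx) _.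
by rewrite addrC mulrC.
Qed.

Lemma deriv_cst c : is_derive x v (fun=> c) 0.
Proof. exact: is_derive_cst. Qed.

Lemma deriv_cmul c f df : is_derive x v f df ->
  is_derive x v (fun y => c * f y) (c * df).
Proof. exact: is_deriveZ. Qed.

Lemma deriv_inv f df : f x != 0 -> is_derive x v f df ->
  is_derive x v (fun y => (f y)^-1) (- (f x)^-1 ^+ 2 * df).
Proof.
move=> fx0 [fx <-]; apply: DeriveDef; first exact: derivableV.
by rewrite deriveV// exprVn.
Qed.

Lemma deriv_sqrt f df : 0 < f x -> is_derive x v f df ->
  is_derive x v (fun y => Num.sqrt (f y)) ((2 * Num.sqrt (f x))^-1 * df).
Proof. by move=> fx0 fx; exact/is_derive_chain/is_derive1_sqrt. Qed.

Lemma deriv_sum (I : Type) (r : seq I) (F : I -> W -> R) (dF : I -> R) :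
  (forall i, is_derive x v (F i) (dF i)) ->
  is_derive x v (fun y => \sum_(i <- r) F i y) (\sum_(i <- r) dF i).
Proof.
move=> H; elim: r => [|i r IH].
  rewrite big_nil; under eq_fun do rewrite big_nil.
  exact: deriv_cst.
rewrite big_cons; under eq_fun do rewrite big_cons.
exact: deriv_add.
Qed.

End DeriveRules.

Section SmoothFunctions.
Variables (R : realType) (n : nat) (V : set 'rV[R]_n).
Hypothesis openV : open V.
Implicit Types f g : 'rV[R]_n -> R.

Definition eq_on f g := forall p, V p -> f p = g p.

Lemma eq_on_near f g p : eq_on f g -> V p -> \near p, f p = g p.
Proof.
move=> fg Vp; apply: filterS fg _; exact: open_nbhs_nbhs.
Qed.

Lemma pder_eq_on f g i : eq_on f g -> eq_on (pder i f) (pder i g).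
Proof. by move=> fg p Vp; apply: near_eq_derive; exact: eq_on_near. Qed.

Lemma iter_pder_eq_on f g s :
  eq_on f g -> eq_on (foldr (@pder R n) f s) (foldr (@pder R n) g s).
Proof. by move=> fg; elim: s => //= i s; exact: pder_eq_on. Qed.

Definition regular_on f := forall p, V p ->
  {for p, continuous f} /\ forall i, derivable f p (delta_mx 0 i).

(* Continuity of the iterated partial derivatives replaces the Frechet
   differentiability of [smooth_on]: it is stable under local equality and
   suffices for the symmetry of second derivatives. *)
Definition csmooth f := forall s, regular_on (foldr (@pder R n) f s).

Lemma smooth_on_csmooth f : smooth_on V f -> csmooth f.
Proof.
move=> fV s p Vp; have df := fV s p Vp; split.
  exact: differentiable_continuous.
by move=> i; exact: diff_derivable.
Qed.

Lemma regular_eq_on f g : eq_on f g -> regular_on f -> regular_on g.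
Proof.
move=> fg fV p Vp; have [fc fd] := fV p Vp; split.
  rewrite /prop_for /continuous_at -(fg p Vp).
  have nfg : {near p, f =1 g} by exact: eq_on_near.
  exact: cvg_trans (near_eq_cvg nfg) fc.
by move=> i; apply: near_eq_derivable (fd i); exact: eq_on_near.
Qed.

Lemma csmooth_eq_on f g : eq_on f g -> csmooth f -> csmooth g.
Proof.
by move=> fg fV s; apply: regular_eq_on (fV s); exact: iter_pder_eq_on.
Qed.

Lemma csmooth_regular f : csmooth f -> regular_on f.
Proof. by move=> /(_ [::]). Qed.

Lemma csmooth_pder f i : csmooth f -> csmooth (pder i f).
Proof. by move=> fV s; rewrite -[foldr _ _ s]/(foldr _ (foldr _ f [:: i]) s) -foldr_cat. Qed.

Lemma csmooth_is_derive f p i : csmooth f -> V p ->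
  is_derive p (delta_mx 0 i) f (pder i f p).
Proof. by move=> /csmooth_regular/[apply] -[_ fd]; exact/derivableP. Qed.

(** Smoothness is proved for a whole class at once: if the class consists of regular functions and
    is closed on [V] under partial derivatives, every iterated derivative agrees on [V] with a
    member. The induction peels off the innermost derivative, which is the last entry of the
    list. *)
Lemma csmooth_coind (S : ('rV[R]_n -> R) -> Prop) :
  (forall f, S f -> regular_on f /\
     forall i, exists2 g, S g & eq_on (pder i f) g) ->
  forall f, S f -> csmooth f.
Proof.
move=> HS f Sf s; elim/last_ind: s f Sf => [|s i IH] f Sf.
  exact: (HS f Sf).1.
rewrite foldr_rcons; have [g Sg fg] := (HS f Sf).2 i.
apply: regular_eq_on (IH g Sg); apply: iter_pder_eq_on => p Vp.
by rewrite fg.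
Qed.

(** A class to feed to [csmooth_coind]: derivatives of products, inverses and roots are built from
    the same operations. This avoids Leibniz formulas for iterated derivatives. *)
Inductive smooth_expr : ('rV[R]_n -> R) -> Prop :=
| SE_base f of csmooth f : smooth_expr f
| SE_cst c : smooth_expr (fun=> c)
| SE_add f g of smooth_expr f & smooth_expr g : smooth_expr (fun p => f p + g p)
| SE_mul f g of smooth_expr f & smooth_expr g : smooth_expr (fun p => f p * g p)
| SE_inv f of smooth_expr f & (forall p, V p -> f p != 0) :
    smooth_expr (fun p => (f p)^-1)
| SE_sqrt f of smooth_expr f & (forall p, V p -> 0 < f p) :
    smooth_expr (fun p => Num.sqrt (f p)).

Lemma smooth_expr_step f : smooth_expr f -> regular_on f /\
  forall i, exists2 g, smooth_expr g & eq_on (pder i f) g.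
Proof.
elim=> {f} [f fV|c|f g Sf [rf IHf] Sg [rg IHg]|f g Sf [rf IHf] Sg [rg IHg]
  |f Sf [rf IHf] f0|f Sf [rf IHf] f0].
- split=> [|i]; first exact: csmooth_regular.
  by exists (pder i f) => //; exact/SE_base/csmooth_pder.
- split=> [p Vp|i]; first by split; [exact: cst_continuous|move=> i; exact: derivable_cst].
  by exists (fun=> 0); [exact: SE_cst|move=> p _; exact: derive_cst].
- split=> [p Vp|i].
    have [fc fd] := rf p Vp; have [gc gd] := rg p Vp.
    by split; [exact: (cvgD fc gc)|move=> i; exact: derivableD].
  have [f' Sf' ff'] := IHf i; have [g' Sg' gg'] := IHg i.
  exists (fun p => f' p + g' p); first exact: SE_add.
  move=> p Vp; have [_ fd] := rf p Vp; have [_ gd] := rg p Vp.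
  by rewrite -ff'// -gg'//; apply: deriveD.
- split=> [p Vp|i].
    have [fc fd] := rf p Vp; have [gc gd] := rg p Vp.
    by split; [exact: (cvgM fc gc)|move=> i; exact: derivableM].
  have [f' Sf' ff'] := IHf i; have [g' Sg' gg'] := IHg i.
  exists (fun p => f' p * g p + f p * g' p); first by apply: SE_add; exact: SE_mul.
  move=> p Vp; have [_ fd] := rf p Vp; have [_ gd] := rg p Vp.
  rewrite -ff'// -gg'//; apply: derive_val.
  by apply: deriv_mul; exact: derivableP.
- split=> [p Vp|i].
    have [fc fd] := rf p Vp.
    by split; [exact: (cvgV (f0 p Vp) fc)|move=> i; apply: derivableV => //; exact: f0].
  have [f' Sf' ff'] := IHf i.
  exists (fun p => -1 * ((f p)^-1 * (f p)^-1) * f' p).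
    apply: SE_mul => //; apply: SE_mul; first exact: SE_cst.
    by apply: SE_mul; exact: SE_inv.
  move=> p Vp; have [_ fd] := rf p Vp.
  rewrite -ff'// mulN1r -expr2; apply: derive_val.
  by apply: deriv_inv; [exact: f0|exact: derivableP].
- split=> [p Vp|i].
    have [fc fd] := rf p Vp; split.
      exact: (@continuous_comp _ _ _ f Num.sqrt p fc (@sqrt_continuous _ _)).
    move=> i; have := deriv_sqrt (f0 p Vp) (derivableP (fd i)).
    by case.
  have [f' Sf' ff'] := IHf i.
  exists (fun p => (2 * Num.sqrt (f p))^-1 * f' p).
    apply: SE_mul => //; apply: SE_inv.
      by apply: SE_mul; [exact: SE_cst|exact: SE_sqrt].
    by move=> p Vp; rewrite mulf_neq0// gt_eqF ?sqrtr_gt0// f0.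
  move=> p Vp; have [_ fd] := rf p Vp.
  rewrite -ff'//; apply: derive_val.
  by apply: deriv_sqrt; [exact: f0|exact: derivableP].
Qed.

Lemma smooth_expr_csmooth f : smooth_expr f -> csmooth f.
Proof. exact/csmooth_coind/smooth_expr_step. Qed.

Lemma csmooth_cst c : csmooth (fun=> c).
Proof. exact/smooth_expr_csmooth/SE_cst. Qed.

Lemma csmoothD f g : csmooth f -> csmooth g -> csmooth (fun p => f p + g p).
Proof.
by move=> fV gV; apply/smooth_expr_csmooth/SE_add; exact: SE_base.
Qed.

Lemma csmoothM f g : csmooth f -> csmooth g -> csmooth (fun p => f p * g p).
Proof.
by move=> fV gV; apply/smooth_expr_csmooth/SE_mul; exact: SE_base.
Qed.

Lemma csmoothV f : csmooth f -> (forall p, V p -> f p != 0) ->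
  csmooth (fun p => (f p)^-1).
Proof. by move=> fV f0; apply/smooth_expr_csmooth/SE_inv => //; exact: SE_base. Qed.

Lemma csmooth_sqrt f : csmooth f -> (forall p, V p -> 0 < f p) ->
  csmooth (fun p => Num.sqrt (f p)).
Proof. by move=> fV f0; apply/smooth_expr_csmooth/SE_sqrt => //; exact: SE_base. Qed.

Lemma csmoothB f g : csmooth f -> csmooth g -> csmooth (fun p => f p - g p).
Proof.
move=> fV gV; have := csmoothD fV (csmoothM (csmooth_cst (-1)) gV).
by apply: csmooth_eq_on => p _; rewrite mulN1r.
Qed.

Lemma csmooth_sum (I : Type) (r : seq I) (P : pred I)
    (F : I -> 'rV[R]_n -> R) :
  (forall i, csmooth (F i)) -> csmooth (fun p => \sum_(i <- r | P i) F i p).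
Proof.
move=> FV; elim: r => [|i r IH].
  by under eq_fun do rewrite big_nil; exact: csmooth_cst.
under eq_fun do rewrite big_cons.
by case: (P i); [exact: csmoothD|exact: IH].
Qed.

Lemma csmooth_prod (I : Type) (r : seq I) (P : pred I)
    (F : I -> 'rV[R]_n -> R) :
  (forall i, csmooth (F i)) -> csmooth (fun p => \prod_(i <- r | P i) F i p).
Proof.
move=> FV; elim: r => [|i r IH].
  by under eq_fun do rewrite big_nil; exact: csmooth_cst.
under eq_fun do rewrite big_cons.
by case: (P i); [exact: csmoothM|exact: IH].
Qed.

Lemma csmooth_det k (A : 'rV[R]_n -> 'M[R]_k) :
  (forall i j, csmooth (fun p => A p i j)) -> csmooth (fun p => \det (A p)).
Proof.
move=> AV; apply: csmooth_sum => s; apply: csmoothM; first exact: csmooth_cst.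
by apply: csmooth_prod => i; exact: AV.
Qed.

(** Cramer's rule: the entries are cofactors divided by the determinant. The formula describes
    [invmx] only at invertible matrices, hence the detour through equality on [V]. *)
Lemma csmooth_invmx k (A : 'rV[R]_n -> 'M[R]_k) :
  (forall i j, csmooth (fun p => A p i j)) ->
  (forall p, V p -> A p \in unitmx) ->
  forall i j, csmooth (fun p => invmx (A p) i j).
Proof.
move=> AV Au i j.
apply: (@csmooth_eq_on (fun p => (\det (A p))^-1 * ((-1) ^+ (j + i) *
    \det (row' j (col' i (A p)))))).
  by move=> p Vp; rewrite /invmx Au// !mxE.
apply: csmoothM.
  by apply: csmoothV => [|p /Au]; [exact: csmooth_det|rewrite unitmxE unitfE].
apply: csmoothM; first exact: csmooth_cst.
apply: csmooth_det => k1 k2.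
by apply: csmooth_eq_on (AV (lift j k1) (lift i k2)) => p _; rewrite !mxE.
Qed.

End SmoothFunctions.

(** * Symmetry of second derivatives *)

Lemma is_derive_line (R : realType) (W : normedModType R) (f : W -> R)
    (u w : W) (t df : R) :
  is_derive (t *: u + w) u f df -> is_derive t 1 (fun h : R => f (h *: u + w)) df.
Proof.
move=> /is_derive_lineP fu.
have -> : (fun h : R => f (h *: u + w)) =
    (fun h : R => f (h *: u + (t *: u + w))) \o (fun h => h - t).
  by apply/funext => h /=; rewrite addrA -scalerDl subrK.
rewrite -[df]mulr1; apply: is_derive1_comp; first by rewrite subrr.
by rewrite -[X in is_derive _ _ _ X]subr0; apply: is_deriveB; exact: is_derive_cst.
Qed.

(** The mean value theorem is used twice, along [u] for the difference [phi] of [f] between two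
    parallel edges, then along [v] for [fu]. The second difference is symmetric in [u] and [v],
    while the right side is a mixed derivative in one prescribed order. *)
Lemma second_difference (R : realType) (W : normedModType R) (f fu fuv : W -> R)
    (u v p : W) (s : R) (D : set W) :
  0 < s ->
  (forall a b, 0 <= a <= s -> 0 <= b <= s -> D (a *: u + (b *: v + p))) ->
  (forall q, D q -> is_derive q u f (fu q)) ->
  (forall q, D q -> is_derive q v fu (fuv q)) ->
  exists a b, [/\ 0 <= a <= s, 0 <= b <= s &
    f (s *: u + (s *: v + p)) - f (s *: u + p) - f (s *: v + p) + f p =
    s * (s * fuv (a *: u + (b *: v + p)))].
Proof.
move=> s0 sD df dfu.
have s00 : 0 <= (0 : R) <= s by apply/andP; split=> //; exact: ltW.
have ss : 0 <= s <= s by apply/andP; split=> //; exact: ltW.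
have Duv a b : 0 <= a <= s -> 0 <= b <= s -> D (b *: v + (a *: u + p)).
  by move=> ha hb; rewrite addrCA; exact: sD.
have Du a : 0 <= a <= s -> D (a *: u + p).
  by move=> ha; have := sD _ 0 ha s00; rewrite scale0r add0r.
pose phi (t : R) := f (t *: u + (s *: v + p)) - f (t *: u + p).
pose dphi (t : R) := fu (t *: u + (s *: v + p)) - fu (t *: u + p).
have dphiP t : 0 <= t <= s -> is_derive t 1 phi (dphi t).
  move=> ht; apply: deriv_sub; apply: is_derive_line; apply: df.
    exact: sD.
  exact: Du.
have cphi : {within `[0, s], continuous phi}.
  apply: derivable_within_continuous => t; rewrite in_itv/= => ht.
  by have [] := dphiP t ht.
have dphiI t : t \in `]0, s[%R -> is_derive t 1 phi (dphi t).
  by rewrite in_itv/= => /andP[t0 ts]; apply: dphiP; apply/andP; split; exact: ltW.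
have [a + phiE] := MVT s0 dphiI cphi.
rewrite in_itv/= => /andP[a0 as_].
have ha : 0 <= a <= s by apply/andP; split; exact: ltW.
pose psi (t : R) := fu (t *: v + (a *: u + p)).
have dpsiP t : 0 <= t <= s ->
    is_derive t 1 psi (fuv (t *: v + (a *: u + p))).
  by move=> ht; apply: is_derive_line; apply: dfu; exact: Duv.
have cpsi : {within `[0, s], continuous psi}.
  apply: derivable_within_continuous => t; rewrite in_itv/= => ht.
  by have [] := dpsiP t ht.
have dpsiI t : t \in `]0, s[%R -> is_derive t 1 psi (fuv (t *: v + (a *: u + p))).
  by rewrite in_itv/= => /andP[t0 ts]; apply: dpsiP; apply/andP; split; exact: ltW.
have [b + psiE] := MVT s0 dpsiI cpsi.
rewrite in_itv/= => /andP[b0 bs].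
exists a, b; split=> //; first by apply/andP; split; exact: ltW.
move: phiE psiE; rewrite /phi /psi /dphi !scale0r !add0r !subr0.
rewrite ![_ *: v + (a *: u + p)]addrCA => phiE psiE.
rewrite psiE in phiE; rewrite (mulrC s (fuv _)) (mulrC s) -phiE.
move: (f (s *: u + _)) (f (s *: u + p)) (f (s *: v + p)) (f p) => x1 x2 x3 x4.
by ring.
Qed.

Section Symmetry.
Variables (R : realType) (n : nat) (V : set 'rV[R]_n).
Hypothesis openV : open V.

Lemma csmooth_pderC f i j : csmooth V f ->
  eq_on V (pder i (pder j f)) (pder j (pder i f)).
Proof.
move=> fV p Vp; apply/eqP; apply: contraT => neq; exfalso.
set A := pder i _ p in neq; set B := pder j _ p in neq.
(* Half the gap: on a small ball each mixed derivative stays within [e] of its value at [p], yet the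
   common second difference makes them take equal values somewhere, so the gap would be smaller than
   itself. *)
pose e := `|A - B| / 2.
have e0 : 0 < e by rewrite divr_gt0// normr_gt0 subr_eq0.
have [cA _] := csmooth_regular (csmooth_pder i (csmooth_pder j fV)) Vp.
have [cB _] := csmooth_regular (csmooth_pder j (csmooth_pder i fV)) Vp.
have near_lt (h : 'rV[R]_n -> R) : {for p, continuous h} ->
    \forall q \near p, `|h p - h q| < e.
  by move=> /cvgrPdist_lt; apply.
have nA := near_lt _ cA; have nB := near_lt _ cB.
have nV : \forall q \near p, V q by exact: open_nbhs_nbhs.
have [r /= r0 rV] := (nbhs_ballP _ _).1 (filterI nV (filterI nA nB)).
(* Coordinate vectors have norm at most 1, so the displacements have norm at most [2 * s], which is
   half of [r]. *)
pose s := r / 4.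
have s0 : 0 < s by rewrite divr_gt0.
have ndelta (k : 'I_n) : `|delta_mx 0 k : 'rV[R]_n| <= 1.
  rewrite [leLHS]/Num.Def.normr/= mx_normrE; apply: bigmax_le => // -[k1 k2] _ /=.
  by rewrite mxE; case: (_ && _); rewrite ?normr1 ?normr0.
have inball k l (a b : R) : 0 <= a <= s -> 0 <= b <= s ->
    ball p r (a *: delta_mx 0 k + (b *: delta_mx 0 l + p)).
  move=> /andP[a0 as_] /andP[b0 bs].
  rewrite -ball_normE /= addrA opprD addrCA subrr addr0 normrN.
  apply: le_lt_trans (ler_normD _ _) _; rewrite !normrZ !ger0_norm//.
  have h1 : a * `|delta_mx 0 k : 'rV[R]_n| <= s.
    by apply: le_trans as_; rewrite ler_piMr.
  have h2 : b * `|delta_mx 0 l : 'rV[R]_n| <= s.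
    by apply: le_trans bs; rewrite ler_piMr.
  by apply: le_lt_trans (lerD h1 h2) _; rewrite /s; lra.
have VD k g q : csmooth V g -> ball p r q ->
    is_derive q (delta_mx 0 k) g (pder k g q).
  by move=> gV /rV[Vq _]; exact: csmooth_is_derive Vq.
have [a [b [ha hb E1]]] := second_difference s0 (inball j i)
  (fun q => @VD j f q fV) (fun q => @VD i _ q (csmooth_pder j fV)).
have [c [d [hc hd E2]]] := second_difference s0 (inball i j)
  (fun q => @VD i f q fV) (fun q => @VD j _ q (csmooth_pder i fV)).
have [_ [+ _]] := rV _ (inball j i _ _ ha hb).
have [_ [_ +]] := rV _ (inball i j _ _ hc hd).
have key (x x' y z w a' b' : R) : x = x' -> x - y - z + w = s * (s * a') ->
    x' - z - y + w = s * (s * b') -> a' = b'.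
  move=> <- e1 e2; apply: (mulfI (lt0r_neq0 s0)); apply: (mulfI (lt0r_neq0 s0)).
  by rewrite -e1 -e2; ring.
have {key E1 E2} := key _ _ _ _ _ _ _ (congr1 f (addrCA _ _ _)) E1 E2.
have fin (x y a' b' : R) : e = `|x - y| / 2 -> `|x - a'| < e -> `|y - b'| < e ->
    a' = b' -> False.
  move=> eE h1 h2 ab; have := ler_normB (x - a') (y - b').
  have -> : x - a' - (y - b') = x - y by rewrite ab; ring.
  by move: h1 h2; rewrite eE; lra.
by move=> E hB hA; exact: fin (erefl e) hA hB E.
Qed.

End Symmetry.

(** * Gauss equation of a hyperquadric *)

Section BilinearForm.
Variables (R : realType) (N : nat).
Implicit Types (Q : 'M[R]_N) (x y z : 'rV[R]_N) (k : R).

(** The double sum has the shape of [gamma], of the induced metric and of the condition on the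
    1-form, which are thereby instances of [bil]; the algebra goes through the matrix form
    [bilE]. *)
Definition bil Q x y : R := \sum_i \sum_j Q i j * x 0 i * y 0 j.

Lemma bilE Q x y : bil Q x y = (x *m Q *m y^T) 0 0.
Proof.
rewrite /bil mxE exchange_big; apply: eq_bigr => j _.
rewrite !mxE mulr_suml; apply: eq_bigr => i _.
by rewrite [Q i j * _]mulrC.
Qed.

Lemma bilDl Q x y z : bil Q (x + y) z = bil Q x z + bil Q y z.
Proof. by rewrite !bilE !mulmxDl mxE. Qed.

Lemma bilDr Q x y z : bil Q z (x + y) = bil Q z x + bil Q z y.
Proof. by rewrite !bilE linearD mulmxDr mxE. Qed.

Lemma bilZl Q k x y : bil Q (k *: x) y = k * bil Q x y.
Proof. by rewrite !bilE -!scalemxAl mxE. Qed.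

Lemma bilZr Q k x y : bil Q x (k *: y) = k * bil Q x y.
Proof. by rewrite !bilE linearZ /= -scalemxAr mxE. Qed.

Lemma bilBl Q x y z : bil Q (x - y) z = bil Q x z - bil Q y z.
Proof. by rewrite -[- y]scaleN1r bilDl bilZl mulN1r. Qed.

Lemma bil_suml Q (I : Type) (r : seq I) (X : I -> 'rV[R]_N) y :
  bil Q (\sum_(i <- r) X i) y = \sum_(i <- r) bil Q (X i) y.
Proof.
elim/big_ind2 : _ => [|x1 s1 x2 s2 <- <-|//]; last by rewrite bilDl.
by rewrite bilE !mul0mx mxE.
Qed.

Lemma bilC Q x y : Q^T = Q -> bil Q x y = bil Q y x.
Proof.
move=> QT; rewrite !bilE.
have -> : y *m Q *m x^T = (x *m Q *m y^T)^T by rewrite !trmx_mul trmxK QT mulmxA.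
by rewrite [RHS]mxE.
Qed.

End BilinearForm.

Lemma deriv_bil (R : realType) N (W : normedModType R) (x v : W)
    (Q : 'M[R]_N) (X Y : W -> 'rV[R]_N) (dX dY : 'rV[R]_N) :
  (forall k, is_derive x v (fun y => X y 0 k) (dX 0 k)) ->
  (forall k, is_derive x v (fun y => Y y 0 k) (dY 0 k)) ->
  is_derive x v (fun y => bil Q (X y) (Y y)) (bil Q dX (Y x) + bil Q (X x) dY).
Proof.
move=> hX hY; rewrite /bil -big_split.
apply: deriv_sum => k /=; rewrite -big_split.
apply: deriv_sum => l /=.
exact: deriv_mul (deriv_cmul _ (hX k)) (hY l).
Qed.

HB.lock Definition vpder (R : realType) n N (i : 'I_n)
    (X : 'rV[R]_n -> 'rV[R]_N) (m : 'rV[R]_n) : 'rV[R]_N :=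
  \row_k pder i (fun p => X p 0 k) m.

Section VectorFunctions.
Variables (R : realType) (n N : nat) (V : set 'rV[R]_n).
Hypothesis openV : open V.
Implicit Types X Y : 'rV[R]_n -> 'rV[R]_N.

Lemma vpderE i X m k : vpder i X m 0 k = pder i (fun p => X p 0 k) m.
Proof. by rewrite vpder.unlock mxE. Qed.

Lemma vpder_fun i X k : (fun m => vpder i X m 0 k) = pder i (fun p => X p 0 k).
Proof. by apply/funext => m; rewrite vpderE. Qed.

Definition vsmooth X := forall k, csmooth V (fun m => X m 0 k).

Lemma vsmooth_vpder i X : vsmooth X -> vsmooth (vpder i X).
Proof.
by move=> XV k; rewrite (vpder_fun i X k); exact: csmooth_pder.
Qed.

Lemma vpderC i j X m : vsmooth X -> V m ->
  vpder i (vpder j X) m = vpder j (vpder i X) m.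
Proof.
move=> XV Vm; apply/rowP => k.
rewrite [LHS]vpderE [RHS]vpderE (vpder_fun j X k) (vpder_fun i X k).
exact: (csmooth_pderC openV i j (XV k) Vm).
Qed.

Lemma csmooth_bil Q X Y : vsmooth X -> vsmooth Y ->
  csmooth V (fun m => bil Q (X m) (Y m)).
Proof.
move=> XV YV; apply: csmooth_sum => // i; apply: csmooth_sum => // j.
apply: csmoothM => //; apply: csmoothM => //; exact: csmooth_cst.
Qed.

Lemma pder_bil Q X Y i m : vsmooth X -> vsmooth Y -> V m ->
  pder i (fun p => bil Q (X p) (Y p)) m =
  bil Q (vpder i X m) (Y m) + bil Q (X m) (vpder i Y m).
Proof.
move=> XV YV Vm; apply: derive_val.
by apply: deriv_bil => k; rewrite vpderE; exact: csmooth_is_derive Vm.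
Qed.

End VectorFunctions.

Lemma sum_mulmx_inv (R : realType) n (A : 'M[R]_n) (T : 'I_n -> R) c :
  A \in unitmx -> \sum_e A c e * (\sum_f invmx A e f * T f) = T c.
Proof.
move=> Au; have := mulKVmx Au (\col_f T f).
move=> /matrixP/(_ c 0); rewrite !mxE => <-.
apply: eq_bigr => e _; rewrite mxE; congr (_ * _).
by apply: eq_bigr => f _; rewrite mxE.
Qed.

(** As [z] is orthogonal to the rows of [J], the Gram matrix of the frame is block diagonal with
    invertible blocks [c0] and [J Q J^T]. So a vector is determined by its pairings with the
    frame. *)
Lemma row_frame_inj (R : realType) n (Q : 'M[R]_(1 + n)) (z : 'rV[R]_(1 + n))
    (J : 'M[R]_(n, 1 + n)) (x : 'rV[R]_(1 + n)) (c0 : R) :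
  Q^T = Q -> c0 != 0 -> z *m Q *m z^T = c0%:M -> J *m Q *m z^T = 0 ->
  J *m Q *m J^T \in unitmx -> x *m Q *m z^T = 0 -> x *m Q *m J^T = 0 -> x = 0.
Proof.
move=> QT c00 zz Jz Ju xz xJ.
pose M := Q *m (col_mx z J)^T.
have zJ : z *m Q *m J^T = 0.
  by apply: trmx_inj; rewrite !trmx_mul trmxK QT mulmxA Jz !trmx0.
have Mu : M \in unitmx.
  suff : col_mx z J *m M \in unitmx by rewrite unitmx_mul => /andP[].
  rewrite mulmxA mul_col_mx tr_col_mx mul_col_mx !mul_mx_row zz zJ Jz.
  rewrite -[col_mx _ _]/(block_mx _ _ _ _) unitmxE det_ublock det_scalar1.
  by rewrite unitrM unitfE c00 -unitmxE.
have xM : x *m M = 0 by rewrite mulmxA tr_col_mx mul_mx_row xz xJ row_mx0.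
by rewrite -(mulmxK Mu x) xM mul0mx.
Qed.

Section GaussEquation.
Variables (R : realType) (n : nat) (V : set 'rV[R]_n).
Variables (Z : 'rV[R]_n -> 'rV[R]_n.+1) (Q : 'M[R]_n.+1) (k c0 : R).
Variable i_ : 'rV[R]_n -> 'M[R]_n.
Hypothesis openV : open V.
Hypothesis ZV : vsmooth V Z.
Hypothesis QT : Q^T = Q.
Hypotheses (k0 : k != 0) (c00 : c0 != 0).
Hypothesis Zc0 : forall m, V m -> bil Q (Z m) (Z m) = c0.
Hypothesis iE : forall m, V m -> forall c d,
  i_ m c d = k * bil Q (vpder c Z m) (vpder d Z m).
Hypothesis iu : forall m, V m -> i_ m \in unitmx.

Local Notation Z1 a := (vpder a Z).
Local Notation Z2 a b := (vpder b (vpder a Z)).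
Local Notation Z3 a b d := (vpder d (vpder b (vpder a Z))).

Lemma bil_pos_tangent m a : V m -> bil Q (Z1 a m) (Z m) = 0.
Proof.
move=> Vm; have := pder_bil Q a ZV ZV Vm.
rewrite (pder_eq_on openV a (g := fun=> c0) Zc0 Vm) /pder derive_cst.
rewrite (bilC (Z m) (Z1 a m) QT) => /esym/eqP.
by rewrite -mulr2n mulrn_eq0 => /eqP.
Qed.

(** Differentiating the orthogonality of [Z] and its tangent vectors gives the second fundamental
    form with respect to the normal [Z]: it is proportional to the metric. *)
Lemma bil_pos_second m a b : V m -> bil Q (Z2 a b m) (Z m) = - (i_ m a b / k).
Proof.
move=> Vm; have Z1V := vsmooth_vpder a ZV.
have := pder_bil Q b Z1V ZV Vm.
rewrite (pder_eq_on openV b (g := fun=> 0) (fun p Vp => bil_pos_tangent a Vp) Vm).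
rewrite /pder derive_cst iE// => /esym/eqP; rewrite addr_eq0 => /eqP ->.
by rewrite mulrAC divff// mul1r.
Qed.

Lemma frame_nondegenerate m x : V m -> bil Q x (Z m) = 0 ->
  (forall a, bil Q x (Z1 a m) = 0) -> x = 0.
Proof.
move=> Vm xZ xZ1.
pose J := \matrix_(a, l) Z1 a m 0 l : 'M[R]_(n, n.+1).
have rowJ a : row a J = Z1 a m by apply/rowP => l; rewrite 2!mxE.
have bilJ (y : 'rV[R]_n.+1) a : (y *m Q *m J^T) 0 a = bil Q y (Z1 a m).
  rewrite bilE mxE [RHS]mxE; apply: eq_bigr => l _.
  by rewrite [J^T _ _]mxE [(Z1 a m)^T _ _]mxE [J _ _]mxE.
have Jbil a (y : 'rV[R]_n.+1) : (J *m Q *m y^T) a 0 = bil Q (Z1 a m) y.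
  by rewrite bilE -rowJ -!row_mul [RHS]mxE.
apply: (@row_frame_inj R n Q (Z m) J x c0) => //.
- by apply/matrixP => c d; rewrite !ord1 -bilE Zc0// mxE eqxx.
- apply/matrixP => c d; rewrite (ord1 d) Jbil [RHS]mxE.
  exact: bil_pos_tangent.
- have -> : J *m Q *m J^T = k^-1 *: i_ m.
    apply/matrixP => c d; rewrite [RHS]mxE iE// mulKf// -bilJ -rowJ.
    by rewrite -!row_mul [RHS]mxE.
  by rewrite unitmxZ ?unitfE ?invr_neq0// iu.
- by apply/matrixP => c d; rewrite !ord1 -bilE xZ mxE.
- by apply/rowP => a; rewrite bilJ xZ1 mxE.
Qed.

Lemma csmooth_metric c d : csmooth V (fun m => i_ m c d).
Proof.
apply: (@csmooth_eq_on _ _ _ openV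
  (fun m => k * bil Q (Z1 c m) (Z1 d m))) => [p Vp|]; first by rewrite iE.
apply: csmoothM => //; first exact: csmooth_cst.
by apply: csmooth_bil => //; exact: vsmooth_vpder.
Qed.

Lemma pder_metric m c d e : V m -> pder e (fun p => i_ p c d) m =
  k * (bil Q (Z2 c e m) (Z1 d m) + bil Q (Z1 c m) (Z2 d e m)).
Proof.
move=> Vm.
rewrite -(pder_bil Q e (vsmooth_vpder c ZV) (vsmooth_vpder d ZV) Vm).
rewrite (pder_eq_on openV e (g := fun p => k * bil Q (Z1 c p) (Z1 d p)) _ Vm).
  apply: derive_val; apply: deriv_cmul; apply: csmooth_is_derive Vm.
  by apply: csmooth_bil => //; exact: vsmooth_vpder.
by move=> p Vp; rewrite iE.
Qed.

(** The three metric derivatives give six products; by symmetry of the second derivatives of [Z]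
    four cancel and the other two coincide. *)
Lemma christoffel_lower m a b c : V m ->
  \sum_e i_ m c e * christoffel i_ a e b m = k * bil Q (Z1 c m) (Z2 a b m).
Proof.
move=> Vm; rewrite /christoffel.
under eq_bigr do rewrite mulrCA; rewrite -mulr_sumr sum_mulmx_inv ?iu//.
rewrite !pder_metric//.
rewrite (vpderC openV a c ZV Vm) (vpderC openV b c ZV Vm).
by rewrite (vpderC openV a b ZV Vm) (bilC (Z1 a m) _ QT); field.
Qed.

Lemma csmooth_christoffel a e b : csmooth V (christoffel i_ a e b).
Proof.
apply: csmoothM => //; first exact: csmooth_cst.
apply: csmooth_sum => // f; apply: csmoothM => //.
  by apply: csmooth_invmx => //; exact: csmooth_metric.
apply: csmoothB => //; first apply: csmoothD => //;
  exact/csmooth_pder/csmooth_metric.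
Qed.

(** The tangential component is read off from [christoffel_lower], the normal one from
    [bil_pos_second]; the difference of the two sides pairs to zero with the whole frame. *)
Lemma gauss_formula m a b : V m ->
  Z2 a b m = \sum_e christoffel i_ a e b m *: Z1 e m
             - (i_ m a b / (k * c0)) *: Z m.
Proof.
move=> Vm; apply/eqP; rewrite -subr_eq0; apply/eqP.
apply: (frame_nondegenerate Vm) => [|c].
  rewrite opprB addrA bilBl bilDl bilZl Zc0// bil_pos_second// bil_suml.
  rewrite big1 => [|e _]; last by rewrite bilZl bil_pos_tangent// mulr0.
  by field; rewrite k0 c00.
rewrite opprB addrA bilBl bilDl bilZl (bilC (Z m) _ QT) bil_pos_tangent//.
rewrite mulr0 addr0 bil_suml; apply: (mulfI k0); rewrite mulr0 mulrBr.
rewrite (bilC (Z2 a b m) _ QT) -christoffel_lower// mulr_sumr -sumrB big1//.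
move=> e _; by rewrite bilZl iE// (bilC (Z1 c m) (Z1 e m) QT); ring.
Qed.

(** The lowered curvature tensor is the antisymmetrization of the left side in [b] and [d].
    Differentiating [christoffel_lower] moves the derivative off the Christoffel symbol; the
    resulting derivatives of the metric cancel the quadratic term and, by the Gauss formula, the
    tangential part of the product of second derivatives. Only the product of the normal parts is
    left beside the third derivative. *)
Lemma half_riemann m a c b d : V m ->
  \sum_e i_ m c e * (pder d (christoffel i_ a e b) m
    + \sum_f christoffel i_ a f b m * christoffel i_ f e d m) =
  k * bil Q (Z1 c m) (Z3 a b d m) + i_ m a b * i_ m c d / (k * c0).
Proof.
move=> Vm.
have Z1V e := vsmooth_vpder e ZV.
have Z2V e f := vsmooth_vpder f (Z1V e).
have dG : \sum_e (pder d (fun p => i_ p c e) m * christoffel i_ a e b m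
      + i_ m c e * pder d (christoffel i_ a e b) m) =
    k * (bil Q (Z2 c d m) (Z2 a b m) + bil Q (Z1 c m) (Z3 a b d m)).
  rewrite -(pder_bil Q d (Z1V c) (Z2V a b) Vm).
  transitivity (pder d
      (fun p => \sum_e i_ p c e * christoffel i_ a e b p) m).
    symmetry; apply: derive_val; apply: deriv_sum => e; apply: deriv_mul.
      by apply: csmooth_is_derive Vm; exact: csmooth_metric.
    by apply: csmooth_is_derive Vm; exact: csmooth_christoffel.
  rewrite (pder_eq_on openV d (g := fun p => k * bil Q (Z1 c p) (Z2 a b p)) _ Vm).
    apply: derive_val; apply: deriv_cmul; apply: csmooth_is_derive Vm.
    exact: csmooth_bil.
  by move=> p Vp; rewrite christoffel_lower.
have quad : \sum_e i_ m c e *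
      (\sum_f christoffel i_ a f b m * christoffel i_ f e d m) =
    \sum_f christoffel i_ a f b m * (k * bil Q (Z1 c m) (Z2 f d m)).
  under eq_bigr do rewrite mulr_sumr; rewrite exchange_big; apply: eq_bigr => f _.
  rewrite -christoffel_lower// mulr_sumr; apply: eq_bigr => e _; exact: mulrCA.
have gf : bil Q (Z2 a b m) (Z2 c d m) =
    \sum_e christoffel i_ a e b m * bil Q (Z1 e m) (Z2 c d m)
    + i_ m a b * i_ m c d / (k * c0 * k).
  rewrite {1}gauss_formula// bilBl bil_suml bilZl (bilC (Z m) _ QT).
  rewrite bil_pos_second//; under eq_bigr do rewrite bilZl.
  by congr (_ + _); field; rewrite k0 c00.
have dm : \sum_e pder d (fun p => i_ p c e) m * christoffel i_ a e b m =
    k * (\sum_e christoffel i_ a e b m * bil Q (Z1 e m) (Z2 c d m)) +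
    \sum_f christoffel i_ a f b m * (k * bil Q (Z1 c m) (Z2 f d m)).
  rewrite mulr_sumr -big_split; apply: eq_bigr => e _ /=.
  by rewrite pder_metric// (bilC (Z2 c d m) _ QT); ring.
under eq_bigr do rewrite mulrDr; rewrite big_split quad.
move: dG; rewrite big_split => /(canRL (addKr _)) /= ->.
rewrite dm (bilC (Z2 c d m) _ QT) gf.
by field; rewrite k0 c00.
Qed.

(** The third derivatives of [Z] are symmetric in [b] and [d], so they cancel and only the normal
    terms survive. *)
Lemma riemann_hyperquadric m a c b d : V m ->
  riemann i_ a c b d m =
  - (k * c0)^-1 * (i_ m c b * i_ m a d - i_ m c d * i_ m a b).
Proof.
move=> Vm; rewrite /riemann /riemann_up.
transitivity (\sum_e i_ m c e * (pder d (christoffel i_ a e b) m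
      + \sum_f christoffel i_ a f b m * christoffel i_ f e d m)
    - \sum_e i_ m c e * (pder b (christoffel i_ a e d) m
      + \sum_f christoffel i_ a f d m * christoffel i_ f e b m)).
  have dist (x p q s t : R) : x * (p - q + s - t) = x * (p + s) - x * (q + t).
    by ring.
  by rewrite -sumrB; apply: eq_bigr => e _; exact: dist.
rewrite !half_riemann// (vpderC openV d b (vsmooth_vpder a ZV) Vm).
by field; rewrite k0 c00.
Qed.

End GaussEquation.

(** * The scalar [f] of the space-like sector *)

(** The conditions give [sin z = 1], so [sin w = 0] for [w = (z - pi/2)/2]; the bounds place [w]
    strictly between [-pi] and [pi/2], where only [w = 0] qualifies. The interval is the range of a
    signed sum of three arctangents. *)
Lemma angle_pihalf (R : realType) (z : R) : cos z = 0 -> 0 < sin z ->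
  - (3 * (pi / 2)) < z < 3 * (pi / 2) -> z = pi / 2.
Proof.
move=> cz sz /andP[z1 z2].
have p0 : 0 < (pi : R) := pi_gt0 R.
pose w := (z - pi / 2) / 2.
suff w0 : sin w = 0.
  have [w_lt0|w_gt0|w00] := ltgtP w 0.
  - have : 0 < sin (- w) by apply: sin_gt0_pi; rewrite /w in w_lt0 *; lra.
    by rewrite sinN w0 oppr0 ltxx.
  - have : 0 < sin w by apply: sin_gt0_pi; rewrite /w in w_gt0 *; lra.
    by rewrite w0 ltxx.
  - by move: w00; rewrite /w; lra.
have sz1 : sin z = 1.
  have := cos2Dsin2 z; rewrite cz expr0n add0r => /eqP.
  by rewrite sqrp_eq1 ?ltW// => /eqP.
have : cos (w + w) = 1.
  have -> : w + w = z - pi / 2 by rewrite /w; field.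
  by rewrite cosB cos_pihalf sin_pihalf cz sz1 mul0r add0r mulr1.
rewrite cosD -!expr2; have := cos2Dsin2 w => h1 h2.
have : sin w ^+ 2 = 0 by lra.
by move/eqP; rewrite sqrf_eq0 => /eqP.
Qed.

Section AtanSum.
Variable (R : realType).
Implicit Types x y t : R.

Lemma cos_atan_gt0 x : 0 < cos (atan x).
Proof. by apply: cos_gt0_pihalf; rewrite atan_gtNpi2 atan_ltpi2. Qed.

Lemma sin_atanE x : sin (atan x) = x * cos (atan x).
Proof. by rewrite -{2}(atanK x) /tan divfK// gt_eqF// cos_atan_gt0. Qed.

(** Up to the positive product of the three cosines, the expression in the equation is the cosine of
    the angle on the left of the conclusion; positivity of [x + y] selects the branch by making its
    sine positive. *)
Lemma atan_sum_pihalf x y t : 1 - x * y + (x + y) * t = 0 -> 0 < x + y ->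
  atan x + atan y - atan t = pi / 2.
Proof.
move=> e xy0.
have [cx cy ct] := And3 (cos_atan_gt0 x) (cos_atan_gt0 y) (cos_atan_gt0 t).
apply: angle_pihalf.
- rewrite cosB cosD sinD !sin_atanE; move: (cos _) (cos _) (cos _) => c1 c2 c3.
  transitivity (c1 * c2 * c3 * (1 - x * y + (x + y) * t)); first by ring.
  by rewrite e mulr0.
- rewrite sinB cosD sinD !sin_atanE.
  have -> : forall c1 c2 c3 : R, (x * c1 * c2 + c1 * (y * c2)) * c3 -
      (c1 * c2 - x * c1 * (y * c2)) * (t * c3) =
      c1 * c2 * c3 * ((x + y) * (1 + t ^+ 2)
        - t * (1 - x * y + (x + y) * t)) by move=> *; ring.
  rewrite e mulr0 subr0 !mulr_gt0//.
  by rewrite ltr_wpDr ?sqr_ge0.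
- have := atan_ltpi2 x; have := atan_ltpi2 y; have := atan_ltpi2 t.
  have := atan_gtNpi2 x; have := atan_gtNpi2 y; have := atan_gtNpi2 t.
  by lra.
Qed.

End AtanSum.

Section Hval.
Variables (R : realType) (s : sector) (g : R).
Hypothesis hg : admissible_g s g.

Lemma hval_sq_gt0 : 0 < 1 + eps R s * (g ^+ 2 / 4).
Proof.
rewrite /eps; case: s hg => [_|[g1 g2]].
  by have := sqr_ge0 g; lra.
have : 0 < (2 - g) * (2 + g) by rewrite mulr_gt0; lra.
by lra.
Qed.

Lemma hval_gt0 : 0 < hval s g.
Proof. by rewrite sqrtr_gt0 hval_sq_gt0. Qed.

Lemma hval_sq : hval s g ^+ 2 = 1 + eps R s * (g ^+ 2 / 4).
Proof. by rewrite sqr_sqrtr// ltW// hval_sq_gt0. Qed.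

End Hval.

(* The three branches of [fval] are pieces of a single smooth function. *)
Lemma fval_atan (R : realType) (g b q : R) :
  admissible_g spacelike g -> 0 < q ->
  fval spacelike g b q =
  - (pi / 2) - atan ((b + g / 2 * q) / (hval spacelike g * q)).
Proof.
move=> hg q0; have h0 := hval_gt0 hg; have := hval_sq hg.
rewrite /fval /Gval; case: hg => g1 g2.
move: (hval spacelike g) h0 => h h0; rewrite /eps => h2.
have hn0 : h != 0 by rewrite gt_eqF.
have qn0 : q != 0 by rewrite gt_eqF.
have Bq : 0 < q ^+ 2 + g * b * q + b ^+ 2.
  have -> : q ^+ 2 + g * b * q + b ^+ 2 = (b + g / 2 * q) ^+ 2 + h ^+ 2 * q ^+ 2.
    by rewrite h2; field.
  by rewrite ltr_wpDl ?sqr_ge0// mulr_gt0// exprn_gt0.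
have key : b != 0 -> let x := (q + g / 2 * b) / (h * b) in
    let y := (b + g / 2 * q) / (h * q) in
    1 - x * y + (x + y) * (g / h / 2) = 0 /\
    x + y = (q ^+ 2 + g * b * q + b ^+ 2) / (h * b * q).
  move=> b0 x y; split; last by rewrite /x /y; field; rewrite hn0 b0 qn0.
  transitivity ((h ^+ 2 - (1 - g ^+ 2 / 4)) / h ^+ 2).
    by rewrite /x /y; field; rewrite hn0 b0 qn0.
  by rewrite h2 mulN1r subrr mul0r.
have [b_lt0|b_gt0|b0] := ltgtP b 0.
(* For [b < 0] the sum of the two tangents is negative, so the addition formula is applied to the
   opposite arguments. *)
- have [//|e xy] := key _; first by rewrite lt_eqF.
  have : 0 < (- ((q + g / 2 * b) / (h * b))) + - ((b + g / 2 * q) / (h * q)).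
    rewrite -opprD xy oppr_gt0 pmulr_rlt0// invr_lt0.
    by rewrite nmulr_rlt0// nmulr_llt0.
  move/(@atan_sum_pihalf _ _ _ (- (g / h / 2))).
  rewrite !atanN => <-; first by lra.
  by rewrite -e; ring.
- have [//|e xy] := key _; first by rewrite gt_eqF.
  have : 0 < (q + g / 2 * b) / (h * b) + (b + g / 2 * q) / (h * q).
    by rewrite xy divr_gt0// !mulr_gt0.
  move/(@atan_sum_pihalf _ _ _ (g / h / 2)) => /(_ e).
  by lra.
- rewrite b0; congr (_ - atan _).
  by field; rewrite hn0 qn0.
Qed.

(** * The factor [J] *)

Section NearLine.
Variables (R : realType) (W : normedModType R) (x v : W).
Implicit Types f g : W -> R.

Lemma is_derive_near_pos f (df : R) : is_derive x v f df -> 0 < f x ->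
  \forall h \near (0 : R), 0 < f (h *: v + x).
Proof.
move=> /is_derive_lineP[/derivable1_diffP/differentiable_continuous fc _] fx.
apply: (cvgr_gt _ fc); by rewrite scale0r add0r.
Qed.

Lemma is_derive_near_eq f g (df : R) :
  (\forall h \near (0 : R), f (h *: v + x) = g (h *: v + x)) ->
  is_derive x v f df -> is_derive x v g df.
Proof.
move=> fg /is_derive_lineP fx; apply/is_derive_lineP.
exact: near_eq_is_derive fg fx.
Qed.

End NearLine.

Lemma eps_timelike (R : realType) : eps R timelike = 1. Proof. by []. Qed.

Lemma eps_spacelike (R : realType) : eps R spacelike = -1. Proof. by []. Qed.

(* [B] as a function of [b] and [q], using [gamma = eps * q ^+ 2]. *)
Definition Bfun (R : realType) (s : sector) (g b q : R) : R :=
  eps R s * q ^+ 2 - g * b * q - b ^+ 2.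

Section DeriveJ.
Variables (R : realType) (s : sector) (g : R).
Hypothesis hg : admissible_g s g.

Variables (W : normedModType R) (x v : W) (b q : W -> R) (db dq : R).
Hypotheses (bD : is_derive x v b db) (qD : is_derive x v q dq).
Hypotheses (q0 : 0 < q x) (B0 : 0 < eps R s * Bfun s g (b x) (q x)).

Lemma deriv_J2 :
  is_derive x v (fun y => Jval s g (b y) (q y) ^+ 2)
    (Jval s g (b x) (q x) ^+ 2
     * (g * (b x * dq - q x * db) / Bfun s g (b x) (q x))).
Proof.
have h0 := hval_gt0 hg; have h2 := hval_sq hg.
have hn0 : hval s g != 0 by rewrite gt_eqF.
have qn0 : q x != 0 by rewrite gt_eqF.
have Bn0 : Bfun s g (b x) (q x) != 0.
  by apply: contraTneq B0 => ->; rewrite mulr0 ltxx.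
case: s hg h0 h2 hn0 B0 Bn0 => hg' h0 h2 hn0 B0' Bn0.
(* The linear factors of [B]: their product is positive by hypothesis and their sum is [2 h q > 0],
   so both are positive. Since [u dw - w du = 2 h (b dq - q db)], the exponent [-G/4] yields the
   coefficient [G h = g]. *)
- pose u y := b y - g_minus timelike g * q y.
  pose w y := g_plus timelike g * q y - b y.
  have uw : u x * w x = Bfun timelike g (b x) (q x).
    transitivity (Bfun timelike g (b x) (q x) + (hval timelike g ^+ 2
      - (1 + eps R timelike * (g ^+ 2 / 4))) * q x ^+ 2).
      by rewrite /u /w /g_plus /g_minus /Bfun eps_timelike; field.
    by rewrite h2 subrr mul0r addr0.
  have upw : 0 < u x + w x.
    have -> : u x + w x = 2 * hval timelike g * q x.
      by rewrite /u /w /g_plus /g_minus; ring.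
    by rewrite !mulr_gt0.
  have uwp : 0 < u x * w x by rewrite uw; move: B0'; rewrite eps_timelike mul1r.
  have u0 : 0 < u x.
    have [//|u0] := ltP 0 (u x).
    by have := uwp; nra.
  have w0 : 0 < w x by move: uwp; rewrite pmulr_rgt0.
  have uD : is_derive x v u (db - g_minus timelike g * dq).
    by apply: deriv_sub => //; exact: deriv_cmul.
  have wD : is_derive x v w (g_plus timelike g * dq - db).
    by apply: deriv_sub => //; exact: deriv_cmul.
  have rD := deriv_mul uD (deriv_inv (lt0r_neq0 w0) wD).
  have r0 : 0 < u x / w x by rewrite divr_gt0.
  pose p : R := - (Gval timelike g / 4).
  have JD := is_derive_chain rD (is_derive1_powR p r0).
  apply: is_derive_eq (deriv_mul JD JD) _.
  rewrite -uw /Jval -/(u x) -/(w x) -/p powRD; last first.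
    by rewrite (lt0r_neq0 r0) implybT.
  rewrite powR_inv1 ?(ltW r0)//.
  have un0 : u x != 0 by rewrite gt_eqF.
  have wn0 : w x != 0 by rewrite gt_eqF.
  move: (powR _ _) => J.
  rewrite /p /Gval.
  have bE : b x = (g_plus timelike g * u x + g_minus timelike g * w x)
      / (2 * hval timelike g).
    by rewrite /u /w /g_plus /g_minus; field.
  have qE : q x = (u x + w x) / (2 * hval timelike g).
    by rewrite /u /w /g_plus /g_minus; field.
  rewrite bE qE; move: (u x) (w x) un0 wn0 => u1 w1 un0 wn0.
  rewrite /g_plus /g_minus; move: (hval _ _) hn0 => h1 hn0.
  by field; rewrite hn0 un0 wn0.
(* By [fval_atan], [f] equals [-pi/2 - atan Y] wherever [q > 0]. From [dY = (q db - b dq)/(h q^2)]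
   and [1 + Y^2 = -B/(h q)^2] the derivative of [atan Y] is [h (b dq - q db)/B], and again
   [G h = g]. *)
- pose Y y := (b y + g / 2 * q y) / (hval spacelike g * q y).
  have hq0 : hval spacelike g * q x != 0 by rewrite mulf_neq0.
  have YD := deriv_mul (deriv_add bD (deriv_cmul (g / 2) qD))
    (@deriv_inv _ _ x v (fun y => hval spacelike g * q y) _ hq0
      (deriv_cmul (hval spacelike g) qD)).
  have fD := deriv_sub (deriv_cst x v (- (pi / 2)))
    (is_derive_chain YD (is_derive1_atan (Y x))).
  have ED := is_derive_chain (deriv_cmul (- (2^-1 * Gval spacelike g)) fD)
    (is_derive_expR _).
  have := deriv_mul ED ED; set J := expR _ => J2D.
  have JE h' : 0 < q (h' *: v + x) ->
      expR (- (2^-1 * Gval spacelike g) * (- (pi / 2) - atan (Y (h' *: v + x)))) =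
      Jval spacelike g (b (h' *: v + x)) (q (h' *: v + x)).
    by move=> q'0; rewrite /Jval fval_atan// mulNr.
  have JxE : J = Jval spacelike g (b x) (q x).
    by have := JE 0; rewrite scale0r add0r; exact.
  apply: is_derive_near_eq; last first.
    apply: is_derive_eq J2D _; rewrite -JxE /Gval.
    have YB : 1 + Y x ^+ 2 = - Bfun spacelike g (b x) (q x) / (hval spacelike g * q x) ^+ 2.
      transitivity (- Bfun spacelike g (b x) (q x) / (hval spacelike g * q x) ^+ 2 +
        (hval spacelike g ^+ 2 - (1 + eps R spacelike * (g ^+ 2 / 4)))
        / hval spacelike g ^+ 2).
        by rewrite /Y /Bfun eps_spacelike; field; rewrite hn0 qn0.
      by rewrite h2 subrr mul0r addr0.
    rewrite YB; move: Bn0 hn0 qn0; clearbody J; clear JxE.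
    move: (b x) (q x) J (hval _ _) (Bfun _ _ _ _) => b1 q1 J h1 B1 Bn0 hn0 qn0.
    by field; rewrite Bn0 hn0 qn0.
  near=> h'; rewrite JE ?expr2//.
  by near: h'; exact: is_derive_near_pos qD q0.
Unshelve. all: by end_near. Qed.

End DeriveJ.

(** * The Finsler metric *)

Section FinsleroidForms.
Variables (R : realType) (s : sector) (N : nat).
Variables (a : 'M[R]_N) (b : 'rV[R]_N) (g : R).
Implicit Types y t : 'rV[R]_N.

Definition rmx : 'M[R]_N := \matrix_(i, j) rform a b i j.

Lemma gammaE y : gamma a b y = bil rmx y y.
Proof. by apply: eq_bigr => i _; apply: eq_bigr => j _; rewrite mxE. Qed.

Lemma bvalE y : bval b y = (y *m b^T) 0 0.
Proof. by rewrite mxE; apply: eq_bigr => i _; rewrite mxE mulrC. Qed.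

Lemma bvalD y t : bval b (y + t) = bval b y + bval b t.
Proof. by rewrite !bvalE mulmxDl mxE. Qed.

Lemma bvalZ k y : bval b (k *: y) = k * bval b y.
Proof. by rewrite !bvalE -scalemxAl mxE. Qed.

Lemma bil_rmx y t : bil rmx y t = bil a y t + bval b y * bval b t.
Proof.
rewrite /bil /bval mulr_suml -big_split; apply: eq_bigr => i _ /=.
rewrite mulr_sumr -big_split; apply: eq_bigr => j _ /=.
by rewrite mxE /rform; ring.
Qed.

Lemma rmx_sym : a^T = a -> rmx^T = rmx.
Proof.
move=> aT; apply/matrixP => i j; rewrite !mxE /rform -{1}aT mxE.
by rewrite [b 0 j * _]mulrC.
Qed.

(* The sector, with the conditions expressed uniformly in the sign [eps]. *)
Definition sect y := 0 < eps R s * gamma a b y /\ 0 < eps R s * Bval a b g y.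

Definition J2 y := Jval s g (bval b y) (qval a b y) ^+ 2.
(** The differential of [q] at [y], in the direction [t]. *)
Definition qlin y t := eps R s * bil rmx y t / qval a b y.
(** Up to the factor [2 * J2 y] this is the differential of [F^2] at [y], so it vanishes on vectors
    tangent to the indicatrix. *)
Definition ell y t := bil rmx y t - (bval b y + g * qval a b y) * bval b t.

Lemma eps_sq : eps R s * eps R s = 1.
Proof. by case: s; rewrite /eps ?mulr1// mulrNN mulr1. Qed.

Section Sector.
Variable y : 'rV[R]_N.
Hypothesis sy : sect y.

Lemma qvalE : qval a b y = Num.sqrt (eps R s * gamma a b y).
Proof.
have [+ _] := sy; rewrite /qval /eps; case: s => [|].
  by rewrite mul1r => /ltW/ger0_norm->.
by rewrite mulN1r oppr_gt0 => /ltW/ler0_norm->.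
Qed.

Lemma qval_gt0 : 0 < qval a b y.
Proof. by rewrite qvalE sqrtr_gt0; case: sy. Qed.

Lemma gamma_qval : gamma a b y = eps R s * qval a b y ^+ 2.
Proof.
by rewrite qvalE sqr_sqrtr ?mulrA ?eps_sq ?mul1r// ltW//; case: sy.
Qed.

Lemma BvalE : Bval a b g y = Bfun s g (bval b y) (qval a b y).
Proof. by rewrite /Bval /Bfun gamma_qval. Qed.

Lemma Bval_neq0 : Bval a b g y != 0.
Proof. by apply/eqP => B0; have [_] := sy; rewrite B0 mulr0 ltxx. Qed.

End Sector.

Hypothesis hg : admissible_g s g.

Lemma in_sector_sect y : in_sector s a b g y -> sect y.
Proof.
rewrite /in_sector /sect; case: s hg => [_|[g1 g2]]; first by rewrite !mul1r.
rewrite /eps !mulN1r !oppr_gt0 => y0; split=> //.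
have q0 : 0 < qval a b y by rewrite sqrtr_gt0 normr_gt0 lt_eqF.
have qE : gamma a b y = - qval a b y ^+ 2.
  by rewrite /qval sqr_sqrtr// ltr0_norm// opprK.
rewrite /Bval qE; move: (bval b y) (qval a b y) q0 => b1 q q0.
(* Completing the square: for [-2 < g < 2] the form [q^2 + g b q + b^2] is positive definite. *)
have -> : - q ^+ 2 - g * b1 * q - b1 ^+ 2 =
  - ((b1 + g / 2 * q) ^+ 2 + (2 - g) * (2 + g) / 4 * q ^+ 2) by field.
rewrite oppr_lt0 ltr_wpDl ?sqr_ge0// mulr_gt0 ?exprn_gt0// divr_gt0// mulr_gt0//; lra.
Qed.

Section Curve.
Variables (W : normedModType R) (x v : W) (X : W -> 'rV[R]_N) (dX : 'rV[R]_N).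
Hypothesis XD : forall k, is_derive x v (fun z => X z 0 k) (dX 0 k).
Hypothesis aT : a^T = a.

Lemma deriv_bval : is_derive x v (fun z => bval b (X z)) (bval b dX).
Proof. by apply: deriv_sum => k; exact: deriv_cmul. Qed.

Lemma deriv_gamma :
  is_derive x v (fun z => gamma a b (X z)) (2 * bil rmx (X x) dX).
Proof.
under eq_fun do rewrite gammaE.
apply: is_derive_eq (deriv_bil _ XD XD) _.
by rewrite (bilC dX _ (rmx_sym aT)) mulrDl mul1r.
Qed.

Hypothesis sX : sect (X x).

Lemma deriv_qval : is_derive x v (fun z => qval a b (X z)) (qlin (X x) dX).
Proof.
have [g0 _] := sX.
have D := deriv_cmul (eps R s) deriv_gamma.
apply: (@is_derive_near_eq _ _ _ _
    (fun z => Num.sqrt (eps R s * gamma a b (X z)))); last first.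
  have SD := @deriv_sqrt _ _ x v (fun z => eps R s * gamma a b (X z)) _ g0 D.
  apply: is_derive_eq SD _.
  rewrite -qvalE// /qlin; field.
  by rewrite gt_eqF// qval_gt0.
near=> h.
have h0 : 0 < eps R s * gamma a b (X (h *: v + x)).
  by near: h; exact: is_derive_near_pos D g0.
rewrite /qval; congr Num.sqrt; move: h0; rewrite /eps; case: s.
  by rewrite mul1r => /ltW/ger0_norm->.
by rewrite mulN1r oppr_gt0 => /ltW/ler0_norm->.
Unshelve. all: by end_near. Qed.

Lemma deriv_Bval : is_derive x v (fun z => Bval a b g (X z))
  (2 * bil rmx (X x) dX - g * (bval b dX * qval a b (X x)
    + bval b (X x) * qlin (X x) dX) - 2 * bval b (X x) * bval b dX).
Proof.
have D := deriv_sub (deriv_sub deriv_gamma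
  (deriv_mul (deriv_cmul g deriv_bval) deriv_qval))
  (deriv_mul deriv_bval deriv_bval).
have -> : (fun z => Bval a b g (X z)) = (fun z => gamma a b (X z)
    - g * bval b (X z) * qval a b (X z) - bval b (X z) * bval b (X z)).
  by apply/funext => z; rewrite -expr2.
by apply: is_derive_eq D _; ring.
Qed.

Lemma deriv_J2X : is_derive x v (fun z => J2 (X z)) (J2 (X x) *
  (g * (bval b (X x) * qlin (X x) dX - qval a b (X x) * bval b dX)
   / Bval a b g (X x))).
Proof.
rewrite BvalE//; apply: deriv_J2 => //.
- exact: deriv_bval.
- exact: deriv_qval.
- exact: qval_gt0.
- by rewrite -BvalE//; case: sX.
Qed.

(** The [dq] terms of [dB] and of [B] times the logarithmic derivative of [J^2] cancel, and so does
    the denominator [B]. *)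
Lemma deriv_F2 : is_derive x v (fun z => F2 s a b g (X z))
  (J2 (X x) * (2 * ell (X x) dX)).
Proof.
apply: is_derive_eq (deriv_mul deriv_Bval deriv_J2X) _.
rewrite /ell; have := Bval_neq0 sX.
move: (Bval _ _ _ _) (J2 _) (qlin _ _) (bil _ _ _) => B1 J1 q1 c1 B0.
by field.
Qed.

Lemma deriv_J2ell t : is_derive x v (fun z => J2 (X z) * (2 * ell (X z) t))
  (2 * (J2 (X x) * (g * (bval b (X x) * qlin (X x) dX
    - qval a b (X x) * bval b dX) / Bval a b g (X x) * ell (X x) t
   + bil rmx dX t - (bval b dX + g * qlin (X x) dX) * bval b t))).
Proof.
have rD : is_derive x v (fun z => bil rmx (X z) t) (bil rmx dX t).
  apply: is_derive_eq.
    apply: (@deriv_bil _ _ _ _ _ rmx X (fun=> t) dX 0) => // k.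
    by rewrite mxE; exact: deriv_cst.
  by rewrite -[X in _ + bil _ _ X](scale0r t) bilZr mul0r addr0.
have eD := deriv_sub rD (deriv_mul (deriv_add deriv_bval
  (deriv_cmul g deriv_qval)) (deriv_cst x v (bval b t))).
apply: is_derive_eq (deriv_mul deriv_J2X (deriv_cmul 2 eD)) _.
by rewrite /ell mulr0 addr0; ring.
Qed.

End Curve.

Hypothesis aT : a^T = a.

Lemma is_derive_coord (y v : 'rV[R]_N) k :
  is_derive y v (fun z : 'rV[R]_N => z 0 k) (v 0 k).
Proof.
apply/is_derive_lineP; under eq_fun do rewrite !mxE.
have D := deriv_add (deriv_mul (is_derive_id (0 : R) 1)
  (deriv_cst (0 : R) 1 (v 0 k))) (deriv_cst (0 : R) 1 (y 0 k)).
by apply: is_derive_eq D _; rewrite mulr0 !addr0 mul1r.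
Qed.

Lemma sect_near (y v : 'rV[R]_N) : sect y -> \forall h \near (0 : R), sect (h *: v + y).
Proof.
move=> sy; have [g0 B0] := sy.
have D1 := deriv_cmul (eps R s) (deriv_gamma (is_derive_coord y v) aT).
have D2 := deriv_cmul (eps R s) (deriv_Bval (is_derive_coord y v) aT sy).
near=> h; split; near: h.
- exact: is_derive_near_pos D1 g0.
- exact: is_derive_near_pos D2 B0.
Unshelve. all: by end_near. Qed.

Lemma finsler_metricE y i j : sect y -> finsler_metric s a b g y i j =
  let di := delta_mx 0 i in let dj := delta_mx 0 j in
  J2 y * (g * (bval b y * qlin y di - qval a b y * bval b di) / Bval a b g y
    * ell y dj + bil rmx di dj - (bval b di + g * qlin y di) * bval b dj).
Proof.
move=> sy /=; rewrite mxE; apply: (mulfI (lt0r_neq0 (ltr0n R 2))).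
rewrite mulrA divff ?mul1r ?lt0r_neq0//; apply: derive_val.
(* The inner partial derivative has its closed form only in the sector, which contains a short
   segment through [y]. *)
apply: is_derive_near_eq (deriv_J2ell (is_derive_coord y _) aT sy (delta_mx 0 j)).
near=> h; symmetry; apply: derive_val.
apply: deriv_F2 => //; first exact: is_derive_coord.
by near: h; exact: sect_near.
Unshelve. all: by end_near. Qed.

End FinsleroidForms.

(** * The Finsler metric as a bilinear form, and Gram matrices *)

Section Contraction.
Variables (R : realType) (N : nat).
Implicit Types (Q : 'M[R]_N) (x y t : 'rV[R]_N).

Lemma bvalDf x y t : bval (x + y) t = bval x t + bval y t.
Proof. by rewrite !bvalE linearD mulmxDr mxE. Qed.

Lemma bvalZf k x t : bval (k *: x) t = k * bval x t.
Proof. by rewrite !bvalE linearZ -scalemxAr mxE. Qed.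

Lemma bil_bval Q y t : bil Q y t = bval (y *m Q) t.
Proof.
rewrite /bil /bval exchange_big; apply: eq_bigr => j _.
by rewrite mxE mulr_suml; apply: eq_bigr => i _; rewrite [Q i j * _]mulrC.
Qed.

Lemma bval_delta x i : bval x (delta_mx 0 i) = x 0 i.
Proof.
rewrite /bval (bigD1 i)//= mxE !eqxx mulr1 big1 ?addr0// => j /negbTE ji.
by rewrite mxE ji andbF mulr0.
Qed.

Lemma bil_delta Q i j : bil Q (delta_mx 0 i) (delta_mx 0 j) = Q i j.
Proof. by rewrite bil_bval bval_delta -rowE mxE. Qed.

Lemma bilDm Q1 Q2 x y : bil (Q1 + Q2) x y = bil Q1 x y + bil Q2 x y.
Proof. by rewrite !bilE mulmxDr mulmxDl mxE. Qed.

Lemma bilZm k Q x y : bil (k *: Q) x y = k * bil Q x y.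
Proof. by rewrite !bilE -scalemxAr -scalemxAl mxE. Qed.

Lemma bil_outer (u w x y : 'rV[R]_N) : bil (u^T *m w) x y = bval u x * bval w y.
Proof.
rewrite /bil /bval mulr_suml; apply: eq_bigr => i _.
rewrite mulr_sumr; apply: eq_bigr => j _.
by rewrite mxE big_ord1 mxE; ring.
Qed.

End Contraction.

Lemma finsler_metric_contract (R : realType) (s : sector) N (a : 'M[R]_N)
    (b : 'rV[R]_N) (g : R) (y t t' : 'rV[R]_N) :
  admissible_g s g -> a^T = a -> sect s a b g y ->
  bil (finsler_metric s a b g y) t t' =
  J2 s a b g y * (g * (bval b y * qlin s a b y t - qval a b y * bval b t)
      / Bval a b g y * ell a b g y t' + bil (rmx a b) t t'
    - (bval b t + g * qlin s a b y t) * bval b t').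
Proof.
move=> hg aT sy.
(* Row vectors representing the linear functionals of the closed form: the metric becomes [rmx] plus
   rank-one matrices, so the formula for its entries extends to arbitrary vectors. *)
pose yr := y *m rmx a b; pose e := eps R s; pose q := qval a b y.
pose u := (bval b y * (e / q)) *: yr + (- q) *: b.
pose l := yr + (- (bval b y + g * q)) *: b.
pose w := b + (g * (e / q)) *: yr.
have uE x : bval u x = bval b y * qlin s a b y x - q * bval b x.
  by rewrite bvalDf !bvalZf -bil_bval /qlin -/e -/q; ring.
have lE x : bval l x = ell a b g y x.
  by rewrite bvalDf bvalZf -bil_bval /ell -/q; ring.
have wE x : bval w x = bval b x + g * qlin s a b y x.
  by rewrite bvalDf bvalZf -bil_bval /qlin -/e -/q; ring.
have -> : finsler_metric s a b g y = J2 s a b g y *: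
    ((g / Bval a b g y) *: (u^T *m l) + rmx a b + (-1) *: (w^T *m b)).
  apply/matrixP => i j; rewrite (finsler_metricE hg aT) //=.
  rewrite -!(bil_delta _ i j) bilZm !bilDm !bilZm !bil_outer uE lE wE.
  by rewrite !bil_delta -/q; ring.
by rewrite bilZm !bilDm !bilZm !bil_outer uE lE wE -/q; ring.
Qed.

(** Pairing a linear relation with [z] kills the coefficient of [z], and row freeness of [J] kills
    the rest, so the frame is invertible. Its Gram matrix is then invertible and block diagonal,
    hence so is the tangential block. *)
Lemma gram_unitmx (R : realType) n (Q : 'M[R]_(1 + n)) (z : 'rV[R]_(1 + n))
    (J : 'M[R]_(n, 1 + n)) (c0 : R) :
  Q^T = Q -> Q \in unitmx -> c0 != 0 -> z *m Q *m z^T = c0%:M ->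
  J *m Q *m z^T = 0 -> row_free J -> J *m Q *m J^T \in unitmx.
Proof.
move=> QT Qu c00 zz Jz Jf.
pose F := col_mx z J.
have zJ : z *m Q *m J^T = 0.
  by apply: trmx_inj; rewrite !trmx_mul trmxK QT mulmxA Jz !trmx0.
have Fu : F \in unitmx.
  rewrite -row_free_unit; apply: inj_row_free => v.
  rewrite -[v]hsubmxK mul_row_col => vF.
  have v1 : lsubmx v = 0.
    have : (lsubmx v *m z + rsubmx v *m J) *m Q *m z^T =
        lsubmx v *m (z *m Q *m z^T) + rsubmx v *m (J *m Q *m z^T).
      by rewrite !mulmxDl !mulmxA.
    rewrite vF !mul0mx Jz mulmx0 addr0 zz mul_mx_scalar => /esym/eqP.
    by rewrite scaler_eq0 (negbTE c00) => /eqP.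
  move: vF; rewrite v1 mul0mx add0r => /(congr1 (mulmx^~ (pinvmx J))).
  by rewrite mulmxKp// mul0mx => ->; rewrite row_mx0.
have : F *m Q *m F^T \in unitmx by rewrite !unitmx_mul Fu Qu unitmx_tr.
rewrite /F mul_col_mx tr_col_mx mul_col_mx !mul_mx_row zz zJ Jz.
rewrite -[col_mx _ _]/(block_mx _ _ _ _) unitmxE det_ublock det_scalar1.
by rewrite unitrM unitfE c00 -unitmxE.
Qed.

(** Applied to the metric, this makes the curvature value unique. If all these minors vanished,
    contracting with the inverse matrix would force row [i1] to be zero. *)
Lemma minor_neq0 (R : realType) n (A : 'M[R]_n) : (1 < n)%N -> A \in unitmx ->
  exists a c b d, A c b * A a d - A c d * A a b != 0.
Proof.
move=> n1 Au; apply: contrapT => H.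
have E a c b d : A c b * A a d = A c d * A a b.
  apply/eqP; rewrite -subr_eq0; apply: contraT => nz.
  by exfalso; apply: H; exists a, c, b, d.
pose i0 := Ordinal (ltnW n1); pose i1 := Ordinal n1.
have A0 d : A i1 d = 0.
  have : \sum_b A i0 b * A i1 d * invmx A b i0 =
         \sum_b A i0 d * A i1 b * invmx A b i0.
    by apply: eq_bigr => b _; rewrite E.
  have Ainv c c' : \sum_b A c b * invmx A b c' = (c == c')%:R.
    by have := mulmxV Au => /matrixP/(_ c c'); rewrite !mxE.
  under eq_bigr do rewrite mulrAC; rewrite -mulr_suml Ainv eqxx mul1r => ->.
  by under eq_bigr do rewrite -mulrA; rewrite -mulr_sumr Ainv mulr0.
have := mulmxV Au => /matrixP/(_ i1 i1); rewrite !mxE eqxx.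
by rewrite big1 => [/eqP|b _]; rewrite ?A0 ?mul0r// eq_sym oner_eq0.
Qed.

Lemma signature_unitmx (R : realType) N (a : 'M[R]_N) :
  has_signature_1_minus a -> a \in unitmx.
Proof.
move=> [_ [P Pu PaP]].
have : P *m a *m P^T \in unitmx.
  rewrite PaP unitmxE det_diag unitfE; apply/prodf_neq0 => i _.
  by rewrite mxE; case: ifP => _; rewrite ?oppr_eq0 oner_eq0.
by rewrite !unitmx_mul => /andP[/andP[]].
Qed.

(** * Embedding of the indicatrix into a hyperquadric *)

Section Embedding.
Variables (R : realType) (s : sector) (n : nat).
Variables (a : 'M[R]_n.+1) (b : 'rV[R]_n.+1) (g : R).
Hypothesis hg : admissible_g s g.
Hypothesis aT : a^T = a.
Hypothesis au : a \in unitmx.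
Hypothesis hb : \sum_i \sum_j invmx a i j * b 0 i * b 0 j = -1.
Implicit Types y t : 'rV[R]_n.+1.

Local Notation e := (eps R s).
Local Notation h := (hval s g).
Local Notation bv := (bval b).
Local Notation qv := (qval a b).
Local Notation Bv := (Bval a b g).

Definition bsharp : 'rV[R]_n.+1 := b *m invmx a.
Definition bproj y := y + bv y *: bsharp.
Definition sqrtB y := Num.sqrt (e * Bv y).

(* On the indicatrix [emb] is, up to the factor [h], an isometry onto an open
   part of the hyperquadric [a(z, z) = eps]. *)
Definition emb y := (sqrtB y)^-1 *:
  (h *: bproj y - (bv y + g / 2 * qv y) *: bsharp).

Lemma emb_coord y k : emb y 0 k = (sqrtB y)^-1 *
  (h * (y 0 k + bv y * bsharp 0 k) - (bv y + g / 2 * qv y) * bsharp 0 k).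
Proof. by rewrite /emb /bproj; move: bsharp => w; rewrite !mxE. Qed.

Lemma bil_bsharp t : bil a bsharp t = bv t.
Proof. by rewrite bil_bval mulmxKV. Qed.

Lemma bval_bsharp : bv bsharp = -1.
Proof.
rewrite -[RHS]hb -/(bil (invmx a) b b) bil_bval bvalE.
rewrite -[RHS]/(bval (b *m invmx a) b) bvalE -/bsharp.
by rewrite !mxE; apply: eq_bigr => i _; rewrite !mxE mulrC.
Qed.

Lemma bval_bproj y : bv (bproj y) = 0.
Proof. by rewrite bvalD bvalZ bval_bsharp mulrN1 subrr. Qed.

Lemma bil_bproj y : bil a (bproj y) (bproj y) = gamma a b y.
Proof.
rewrite /bproj bilDl bilZl bil_bsharp -/(bproj y) bval_bproj mulr0 addr0.
by rewrite bilDr bilZr (bilC y bsharp aT) bil_bsharp gammaE bil_rmx.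
Qed.

Section AtPoint.
Variable y : 'rV[R]_n.+1.
Hypothesis sy : sect s a b g y.

Lemma sqrtB_gt0 : 0 < sqrtB y.
Proof. by rewrite sqrtr_gt0; case: sy. Qed.

Lemma sqrtB_sq : sqrtB y ^+ 2 = e * Bv y.
Proof. by rewrite sqr_sqrtr// ltW//; case: sy. Qed.

Lemma BvE : Bv y = e * sqrtB y ^+ 2.
Proof. by rewrite sqrtB_sq mulrA eps_sq mul1r. Qed.

Lemma emb_norm : bil a (emb y) (emb y) = e.
Proof.
have S0 := sqrtB_gt0; have q0 := qval_gt0 sy.
rewrite /emb bilZl bilZr; set w := bv y + _.
have -> : h *: bproj y - w *: bsharp = h *: bproj y + (- w) *: bsharp.
  by rewrite scaleNr.
rewrite bilDl !bilZl !bilDr !bilZr (bilC (bproj y) bsharp aT) !bil_bsharp.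
rewrite bval_bproj bval_bsharp bil_bproj.
have := BvE; rewrite (BvalE sy) (gamma_qval sy) /Bfun => BE.
have := hval_sq hg => h2.
have S2 : sqrtB y ^+ 2 != 0 by rewrite expf_neq0// gt_eqF.
apply: (mulIf S2); rewrite -BE; move: S0 h2 (eps_sq R s); rewrite /w {BE S2}.
move: (eps R s) (sqrtB y) (qv y) q0 (bv y) (hval s g).
move=> e0 S q q0 b0 h0 S0 h2 e2.
transitivity (e0 * q ^+ 2 - g * b0 * q - b0 ^+ 2
   + (h0 ^+ 2 - (1 + e0 * (g ^+ 2 / 4))) * e0 * q ^+ 2
   + (e0 * e0 - 1) * (g ^+ 2 / 4) * q ^+ 2).
  by field; rewrite gt_eqF.
by rewrite h2 e2 !subrr !mul0r !addr0.
Qed.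

(** The differential of [emb] sends a tangent vector [t] to [h / sqrtB] times [t + b(t) embdir]. The
    second term comes from the variation of [sqrtB]; in the first, [h^2 = 1 + eps g^2/4] turns the
    coefficient [h - 1 - eps g^2/4] of [b#] into [h (1 - h)]. *)
Definition embdir := (1 - h) *: bsharp - (e * g / (2 * qv y)) *: bproj y.

Lemma embdir_coord k : embdir 0 k = (1 - h) * bsharp 0 k
  - e * g / (2 * qv y) * (y 0 k + bv y * bsharp 0 k).
Proof. by rewrite /embdir /bproj; move: bsharp => w; rewrite !mxE. Qed.

Lemma bval_embdir : bv embdir = h - 1.
Proof.
rewrite /embdir -scaleNr bvalD !bvalZ bval_bsharp bval_bproj; ring.
Qed.

Lemma bil_embdir t : ell a b g y t = 0 ->
  bil a embdir t = (1 - h - e * g / (2 * qv y) * (g * qv y + bv y)) * bv t.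
Proof.
rewrite /ell bil_rmx => /eqP; rewrite subr_eq0 => /eqP et.
have yt : bil a y t = g * qv y * bv t.
  by apply: (addIr (bv y * bv t)); rewrite et; ring.
rewrite /embdir -scaleNr bilDl !bilZl bil_bsharp /bproj bilDl bilZl bil_bsharp yt.
by ring.
Qed.

Lemma bil_embdir2 :
  bil a embdir embdir = - (1 - h) ^+ 2 + e * g ^+ 2 / 4.
Proof.
have q0 : qv y != 0 by rewrite gt_eqF// (qval_gt0 sy).
rewrite /embdir -scaleNr bilDl !bilZl !bilDr !bilZr.
rewrite (bilC (bproj y) bsharp aT) !bil_bsharp.
rewrite bval_bproj bval_bsharp bil_bproj (gamma_qval sy).
rewrite mulr0 addr0 mulr0 add0r; have := eps_sq R s.
move: (eps R s) (qv y) q0 => e0 q q0 e2.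
transitivity (- (1 - h) ^+ 2 + e0 * (e0 * e0) * g ^+ 2 / 4); first by field.
by rewrite e2 mulr1.
Qed.

(** On the indicatrix [J2] is the inverse of [sqrtB^2], and the rank-one term of the Hessian
    containing [ell y t'] drops out. Tangency also expresses [a(y, t)] and [dq(t)] as multiples of
    [b(t)], so both sides are combinations of [a(t, t')] and [b(t) b(t')]. *)
Lemma emb_gram (t t' : 'rV[R]_n.+1) : F2 s a b g y = e ->
  ell a b g y t = 0 -> ell a b g y t' = 0 ->
  let k := (sqrtB y)^-1 * h in
  bil a (k *: (t + bv t *: embdir)) (k *: (t' + bv t' *: embdir)) =
  h ^+ 2 * bil (finsler_metric s a b g y) t t'.
Proof.
move=> yF et et' k.
have q0 : qv y != 0 by rewrite gt_eqF// (qval_gt0 sy).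
have S0 : sqrtB y != 0 by rewrite gt_eqF// sqrtB_gt0.
have J2E : J2 s a b g y = (sqrtB y ^+ 2)^-1.
  have B0 := Bval_neq0 sy.
  apply: (mulfI B0); rewrite [LHS]yF {1}BvE mulfK// expf_neq0//.
rewrite (finsler_metric_contract _ _ hg aT sy) J2E et' mulr0 add0r.
have qt : qlin s a b y t = e * (bv y + g * qv y) * bv t / qv y.
  move/eqP: et; rewrite /ell subr_eq0 => /eqP et.
  by rewrite /qlin et mulrA.
rewrite qt bil_rmx bilZl bilZr !bilDl !bilDr !bilZl !bilZr.
rewrite (bilC t embdir aT) bil_embdir2 !bil_embdir// /k.
have h2 := hval_sq hg.
move: (bil a t t') (bv t) (bv t') (bv y) => att b1 b2 b0.
move: h2 q0 S0; move: (sqrtB y) (qv y) (hval s g) (eps R s).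
move=> S q h0 e0 h2 q0 S0.
transitivity (h0 ^+ 2 * ((S ^+ 2)^-1 *
  (att + b1 * b2 - (b1 + g * (e0 * (b0 + g * q) * b1 / q)) * b2))
   + h0 ^+ 2 * (S ^+ 2)^-1 * b1 * b2 *
     ((1 + e0 * (g ^+ 2 / 4)) - h0 ^+ 2)).
  by field; rewrite q0 S0.
by rewrite h2 subrr mulr0 addr0.
Qed.

End AtPoint.
End Embedding.

(** * The indicatrix in local coordinates *)

Section IndicatrixChart.
Variables (R : realType) (s : sector) (n : nat).
Variables (a : 'M[R]_n.+1) (b : 'rV[R]_n.+1) (g : R).
Hypothesis hg : admissible_g s g.
Hypothesis aT : a^T = a.
Hypothesis au : a \in unitmx.
Hypothesis hb : \sum_i \sum_j invmx a i j * b 0 i * b 0 j = -1.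
Variables (V : set 'rV[R]_n) (L : 'rV[R]_n -> 'rV[R]_n.+1).
Hypothesis openV : open V.
Hypothesis LV : vsmooth V L.
Hypothesis LJ : forall m, V m -> row_free (param_jacobian L m).
Hypothesis LI : forall m, V m -> indicatrix s a b g (L m).

Local Notation e := (eps R s).
Local Notation h := (hval s g).
Local Notation Z := (fun m => emb s a b g (L m)).

Let LS m : V m -> sect s a b g (L m).
Proof. by move=> /LI[/(in_sector_sect hg)]. Qed.

Let LF m : V m -> F2 s a b g (L m) = e.
Proof. by move=> /LI[]. Qed.

Let LD m c : V m ->
  forall k, is_derive m (delta_mx 0 c) (fun p => L p 0 k) (vpder c L m 0 k).
Proof. by move=> Vm k; rewrite vpderE; exact: csmooth_is_derive Vm. Qed.

Lemma ell_tangent m c : V m -> ell a b g (L m) (vpder c L m) = 0.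
Proof.
move=> Vm; have sL := LS Vm.
have := derive_val (is_derive := deriv_F2 hg (LD c Vm) aT sL).
rewrite -/(pder c _ m) (pder_eq_on openV c (g := fun=> e) LF Vm).
rewrite /pder derive_cst => /esym/eqP; rewrite mulf_eq0 => /orP[/eqP J0|].
  have := LF Vm; rewrite /F2 -/(J2 s a b g (L m)) J0 mulr0 => /esym e0.
  by have := eps_sq R s; rewrite e0 mul0r => /eqP; rewrite eq_sym oner_eq0.
by rewrite mulf_eq0 pnatr_eq0 => /eqP.
Qed.

(** Along the indicatrix the logarithmic derivative of [sqrtB] is therefore [eps g b(t) / (2 q)],
    the coefficient of [bproj] in [embdir]. *)
Lemma eps_Bval_deriv m c (t := vpder c L m) : V m ->
  e * (2 * bil (rmx a b) (L m) t - g * (bval b t * qval a b (L m)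
    + bval b (L m) * qlin s a b (L m) t) - 2 * bval b (L m) * bval b t) =
  e * g / qval a b (L m) * sqrtB s a b g (L m) ^+ 2 * bval b t.
Proof.
move=> Vm; have sL := LS Vm; have := ell_tangent c Vm.
rewrite -/t /ell => /eqP; rewrite subr_eq0 => /eqP rt.
have q0 : qval a b (L m) != 0 by rewrite gt_eqF// (qval_gt0 sL).
rewrite (sqrtB_sq sL) (BvalE sL) /qlin rt /Bfun; move: q0 (eps_sq R s).
move: (eps R s) (qval a b _) (bval b t) (bval b _) => e0 q bt b0 q0 e2.
apply/eqP; rewrite -subr_eq0; apply/eqP.
transitivity ((1 - e0 * e0) * (bt * e0 * g * q)); first by field.
by rewrite e2 subrr mul0r.
Qed.

(** As [J] does not occur in [emb], field operations and square roots of functions positive on the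
    sector suffice. *)
Lemma vsmooth_emb : vsmooth V Z.
Proof.
have cst c := csmooth_cst openV c.
have bV : csmooth V (fun m => bval b (L m)).
  by apply: (csmooth_sum openV) => i; exact: csmoothM.
have gV : csmooth V (fun m => gamma a b (L m)).
  apply: (csmooth_eq_on openV) (csmooth_bil openV (rmx a b) LV LV) => m _.
  by rewrite gammaE.
have qV : csmooth V (fun m => qval a b (L m)).
  apply: (@csmooth_eq_on _ _ _ openV
    (fun m => Num.sqrt (e * gamma a b (L m)))) => [m Vm|].
    by rewrite (qvalE (LS Vm)).
  apply: (csmooth_sqrt openV); first exact: (csmoothM openV (cst e) gV).
  by move=> m /LS[].
have BV : csmooth V (fun m => Bval a b g (L m)) :=
  csmoothB openV (csmoothB openV gV (csmoothM openV (csmoothM openV (cst g) bV) qV))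
    (csmoothM openV bV bV).
have SV : csmooth V (fun m => (sqrtB s a b g (L m))^-1).
  apply: (csmoothV openV); last by move=> m Vm; rewrite gt_eqF// (sqrtB_gt0 (LS Vm)).
  apply: (csmooth_sqrt openV); first exact: (csmoothM openV (cst e) BV).
  by move=> m /LS[].
move=> k; pose bk := bsharp a b 0 k.
have := csmoothM openV SV (csmoothB openV
  (csmoothM openV (cst h)
    (csmoothD openV (LV k) (csmoothM openV bV (cst bk))))
  (csmoothM openV (csmoothD openV bV (csmoothM openV (cst (g / 2)) qV))
    (cst bk))).
by move=> H; apply: (csmooth_eq_on openV _ H) => m _; rewrite emb_coord.
Qed.

Lemma vpder_emb m c (t := vpder c L m) : V m -> vpder c Z m =
  ((sqrtB s a b g (L m))^-1 * h) *:
    (t + bval b t *: embdir s a b g (L m)).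
Proof.
move=> Vm; have sL := LS Vm; apply/rowP => k; rewrite vpderE.
pose bk := bsharp a b 0 k.
have bD := deriv_bval b (LD c Vm).
have qD := deriv_qval (LD c Vm) aT sL.
have BD := deriv_cmul e (deriv_Bval (LD c Vm) aT sL).
rewrite eps_Bval_deriv// in BD.
have SD := @deriv_sqrt _ _ m _ (fun p => e * Bval a b g (L p)) _ (proj2 sL) BD.
have S0 : sqrtB s a b g (L m) != 0 by rewrite gt_eqF// (sqrtB_gt0 sL).
have ID := @deriv_inv _ _ m _ (fun p => sqrtB s a b g (L p)) _ S0 SD.
have ZD := deriv_mul ID (deriv_sub
  (deriv_cmul h (deriv_add (LD c Vm k) (deriv_mul bD (deriv_cst m _ bk))))
  (deriv_mul (deriv_add bD (deriv_cmul (g / 2) qD)) (deriv_cst m _ bk))).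
have -> : (fun p => Z p 0 k) = (fun p => (sqrtB s a b g (L p))^-1 *
   (h * (L p 0 k + bval b (L p) * bk)
    - (bval b (L p) + g / 2 * qval a b (L p)) * bk)).
  by apply/funext => p; rewrite emb_coord.
apply: etrans (derive_val (is_derive := ZD)) _.
have qt : qlin s a b (L m) t =
    e * (bval b (L m) + g * qval a b (L m)) * bval b t / qval a b (L m).
  have := ell_tangent c Vm; rewrite /ell => /eqP; rewrite subr_eq0 => /eqP rt.
  by rewrite /qlin rt mulrA.
have q0 : qval a b (L m) != 0 by rewrite gt_eqF// (qval_gt0 sL).
rewrite -/t qt -/(sqrtB s a b g (L m)) mxE mxE mxE embdir_coord -/bk.
move: (hval_sq hg) q0 S0.
move: (hval s g) (eps R s) (qval a b _) (sqrtB _ _ _ _ _) => h0 e0 q S h2 q0 S0.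
clearbody bk; move: (bval b t) (bval b (L m)) (t 0 k) (L m 0 k) => bt b0 tk Lk.
transitivity (S^-1 * h0 * (tk + bt * ((1 - h0) * bk
    - e0 * g / (2 * q) * (Lk + b0 * bk)))
  + S^-1 * bt * bk * (h0 ^+ 2 - (1 + e0 * (g ^+ 2 / 4)))).
  by field; rewrite q0 S0.
by rewrite h2 subrr mulr0 addr0.
Qed.

Lemma induced_metricE m c d : V m ->
  induced_metric s a b g L m c d =
  (h ^+ 2)^-1 * bil a (vpder c Z m) (vpder d Z m).
Proof.
move=> Vm; rewrite !vpder_emb// (emb_gram hg aT au hb (LS Vm) (LF Vm));
  [|exact: ell_tangent..].
rewrite mulKf ?expf_neq0 ?gt_eqF ?hval_gt0// mxE.
by apply: eq_bigr => i _; apply: eq_bigr => j _; rewrite !vpderE !mxE.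
Qed.

Lemma eps_neq0 : e != 0.
Proof.
by apply/eqP => e0; have := eps_sq R s; rewrite e0 mul0r => /eqP; rewrite eq_sym oner_eq0.
Qed.

(** The hyperquadric is nondegenerate, so it is enough that [Z] is an immersion; then [gram_unitmx]
    applies with the position vector as normal. *)
Lemma induced_unitmx m : V m -> induced_metric s a b g L m \in unitmx.
Proof.
move=> Vm; have sL := LS Vm.
have h0 : h != 0 by rewrite gt_eqF ?hval_gt0.
pose J := \matrix_(c, l) vpder c Z m 0 l : 'M[R]_(n, n.+1).
have rowJ c : row c J = vpder c Z m by apply/rowP => l; rewrite 2!mxE.
have JE : J *m a *m J^T = h ^+ 2 *: induced_metric s a b g L m.
  apply/matrixP => c d; rewrite [RHS]mxE induced_metricE// mulVKf ?expf_neq0//.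
  rewrite bilE mxE [RHS]mxE; apply: eq_bigr => l _; rewrite -!rowJ -row_mul.
  by rewrite [row c _ _ _]mxE [J^T _ _]mxE [(row d J)^T _ _]mxE [row d J _ _]mxE.
suff : J *m a *m J^T \in unitmx.
  by rewrite JE unitmxZ// unitfE expf_neq0.
pose k := (sqrtB s a b g (L m))^-1 * h.
have k0 : k != 0 by rewrite mulf_neq0// invr_neq0// gt_eqF// (sqrtB_gt0 sL).
apply: (@gram_unitmx R n a (Z m) J e) => //.
- exact: eps_neq0.
- by apply/matrixP => c d; rewrite !ord1 -bilE (emb_norm hg aT au hb sL) mxE eqxx.
- apply/matrixP => c d; rewrite (ord1 d) [RHS]mxE.
  have -> : (J *m a *m (Z m)^T) c 0 = bil a (vpder c Z m) (Z m).
    by rewrite bilE -rowJ -!row_mul [RHS]mxE.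
  apply: (bil_pos_tangent openV vsmooth_emb aT) Vm => p Vp.
  exact: emb_norm (LS Vp).
- apply: inj_row_free => v.
  pose t := v *m param_jacobian L m.
  have JX : J = k *: (param_jacobian L m
      + (param_jacobian L m *m b^T) *m embdir s a b g (L m)).
    have PJ c : row c (param_jacobian L m) = vpder c L m.
      by apply/rowP => l; rewrite vpderE !mxE.
    apply/row_matrixP => c; rewrite rowJ vpder_emb// -PJ.
    have rowD (A B : 'M[R]_(n, n.+1)) : row c (k *: (A + B)) =
        k *: (row c A + row c B) by rewrite -linearD -linearZ.
    rewrite rowD -/k; congr (_ *: (_ + _)).
    by rewrite !row_mul [_ *m b^T]mx11_scalar -bvalE mul_scalar_mx.
  rewrite JX -scalemxAr mulmxDr !mulmxA -/t => /eqP.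
  rewrite scaler_eq0 (negbTE k0) /= [t *m b^T]mx11_scalar -bvalE mul_scalar_mx.
  move=> /eqP tE.
  (* Since [b(embdir) = h - 1], applying [b] to the relation leaves [h b(t) = 0]. *)
  have bt0 : bval b t = 0.
    have := congr1 (bval b) tE; rewrite bvalD bvalZ (bval_embdir _ _ hb).
    rewrite [RHS]bvalE mul0mx mxE => bt.
    by apply: (mulIf h0); rewrite mul0r -bt; ring.
  move: tE; rewrite bt0 scale0r addr0 /t => vJ.
  by have := mulmxKp (LJ Vm) v; rewrite vJ mul0mx.
Qed.

Lemma riemann_induced m a' c b' d : V m ->
  riemann (induced_metric s a b g L) a' c b' d m =
  - e * h ^+ 2 *
    (induced_metric s a b g L m c b' * induced_metric s a b g L m a' d
     - induced_metric s a b g L m c d * induced_metric s a b g L m a' b').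
Proof.
move=> Vm; have h0 : h != 0 by rewrite gt_eqF ?hval_gt0.
rewrite (@riemann_hyperquadric R n V Z a (h ^+ 2)^-1 e _ openV vsmooth_emb aT)//.
- congr (_ * _); rewrite invfM invrK.
  have -> : e^-1 = e by apply: (mulfI eps_neq0); rewrite mulfV ?eps_neq0 ?eps_sq.
  by rewrite mulNr mulrC.
- by rewrite invr_neq0// expf_neq0.
- exact: eps_neq0.
- by move=> p Vp; exact: emb_norm (LS Vp).
- by move=> p Vp c' d'; exact: induced_metricE.
- exact: induced_unitmx.
Qed.

End IndicatrixChart.

Theorem mainTheorem4 (R : realType) (N : nat) (hN : (3 <= N)%N) (s : sector)
    (a : 'M[R]_N) (b : 'rV[R]_N) (g : R)
    (ha : has_signature_1_minus a)
    (hb : \sum_i \sum_j invmx a i j * b 0 i * b 0 j = -1)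
    (hg : admissible_g s g)
    (V : set 'rV[R]_N.-1) (L : 'rV[R]_N.-1 -> 'rV[R]_N)
    (hL : local_parametrization s a b g V L) :
  [/\ forall m, V m -> induced_metric s a b g L m \in unitmx,
      forall m, V m -> forall a' c b' d : 'I_N.-1,
        riemann (induced_metric s a b g L) a' c b' d m =
        - eps R s * hval s g ^+ 2 *
          (induced_metric s a b g L m c b' * induced_metric s a b g L m a' d
           - induced_metric s a b g L m c d * induced_metric s a b g L m a' b'),
      forall K : R,
        curvature_value (induced_metric s a b g L) V K <->
        K = - eps R s * hval s g ^+ 2
    & match s with
      | timelike => - eps R s * hval s g ^+ 2 = - (1 + g ^+ 2 / 4) /\
                    - eps R s * hval s g ^+ 2 <= -1
      | spacelike => - eps R s * hval s g ^+ 2 = 1 - g ^+ 2 / 4 /\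
                     - eps R s * hval s g ^+ 2 <= 1
      end].
Proof.
have aT : a^T = a by case: ha.
have au := signature_unitmx ha.
case: N hN a b ha hb V L hL aT au => [//|n] hN a b _ hb V L hL aT au.
have [[openV V0] Ls LJ _ LI] := hL.
have LV : vsmooth V L by move=> k; apply: smooth_on_csmooth; exact: Ls.
have Iu m : V m -> induced_metric s a b g L m \in unitmx.
  exact: (induced_unitmx hg aT au hb openV LV LJ LI).
have IR m a' c b' d : V m -> _ :=
  @riemann_induced R s n a b g hg aT au hb V L openV LV LJ LI m a' c b' d.
split=> //.
- by move=> m Vm a' c b' d; exact: IR.
- move=> K; split=> [HK|-> m Vm a' c b' d]; last exact: IR.
  (* Uniqueness of [K] uses one point of [V] and one choice of indices with nonzero right-hand
     factor; the latter exists because the indicatrix has dimension at least 2. *)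
  have [m Vm] := V0.
  have [a' [c [b' [d nz]]]] := minor_neq0 hN (Iu m Vm).
  by apply: (mulIf nz); rewrite -HK// IR.
- rewrite (hval_sq hg); have := sqr_ge0 g; rewrite /eps => g2.
  by case: s {hg hL LI Iu IR}; (split; [ring|lra]).
Qed.
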